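(* Let $G\rightrightarrows M$ be a Lie groupoid, let $(\mathcal{E},\partial)$ be a bounded $\mathbb{Z}$-graded cochain complex of finite-dimensional vector bundles over $M$, and let $\Delta$ be a unital representation up to weak homotopy of $G$ on $(\mathcal{E},\partial)$. Then there is a canonically induced representation $\hat\Delta$ of $G$ on $\mathrm{Ber}(\mathcal{E})$.
   Context: Vector bundles are real. The maps $s,t\colon G\to M$ are the source and target maps of the Lie groupoid, $1_x\in G$ is the unit at $x\in M$, and $G^{(2)}=\{(g,h)\in G\times G: s(g)=t(h)\}$ is the space of composable pairs. The complex is $\mathcal{E}=\bigoplus_i E^i$, where the $E^i$ are vector bundles over $M$, with coboundary operator $\partial^i\colon E^i\to E^{i+1}$; bounded means that $E^i=0$ for all but finitely many $i$. A representation of $G$ on a line bundle $L\to M$ assigns to each $g\in G$ a linear isomorphism $\hat\Delta_g\colon L_{s(g)}\to L_{t(g)}$, smoothly depending on $g$, such that $\hat\Delta_{gh}=\hat\Delta_g\hat\Delta_h$ for all $(g,h)\in G^{(2)}$. A representation up to weak homotopy of $G$ on the complex $(\mathcal{E},\partial)$ is a smooth map that associates to each $g\in G$ a chain map $\Delta_g\colon(\mathcal{E}_{s(g)},\partial)\to(\mathcal{E}_{t(g)},\partial)$, such that $\Delta_g\Delta_h$ is chain homotopic to $\Delta_{gh}$ for all $(g,h)\in G^{(2)}$. It is unital if $\Delta_{1_x}=\mathrm{id}$ for all $x\in M$. The maps $\Delta_g$ are not required to be invertible. The Berezinian bundle $\mathrm{Ber}(\mathcal{E})$ is that of the $\mathbb{Z}_2$-graded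 vector bundle obtained by reducing the grading on $\mathcal{E}$ modulo $2$: with $\mathcal{E}^{\mathrm{ev}}=\bigoplus_i E^{2i}$ and $\mathcal{E}^{\mathrm{odd}}=\bigoplus_i E^{2i+1}$, it is the line bundle $\mathrm{Ber}(\mathcal{E})=\wedge^{\mathrm{top}}\mathcal{E}^{\mathrm{ev}}\otimes\wedge^{\mathrm{top}}(\mathcal{E}^{\mathrm{odd}})^*$ over $M$. *)

(* Defs.v *)
From HB Require Import structures.
From mathcomp Require Import all_boot all_order all_algebra.
From mathcomp Require Import all_classical all_reals all_analysis.

Set Implicit Arguments.
Unset Strict Implicit.
Unset Printing Implicit Defensive.

Import Order.TTheory GRing.Theory Num.Theory.
Import numFieldNormedType.Exports.

Local Open Scope classical_set_scope.
Local Open Scope ring_scope.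

Section Submodule.
Context (R : pzRingType) (W : lmodType R) (P : {pred W}).

(* The closure proof is a parameter of the type so that the module structure
   can be inferred from the type alone. *)
Record submod (cP : submod_closed P) :=
  Submod { submod_val :> W ; submod_valP : submod_val \in P }.

Variable cP : submod_closed P.

HB.instance Definition _ := [isSub of submod cP for @submod_val cP].
HB.instance Definition _ := [Choice of submod cP by <:].
HB.instance Definition _ :=
  GRing.SubChoice_isSubLmodule.Build R W P (submod cP)
    (GRing.submod_closed_semi cP).

End Submodule.

Section PiModule.
Context (R : pzRingType) (I : Type) (V : I -> lmodType R).

Definition pi_mod := forall i, V i.

HB.instance Definition _ := gen_eqMixin pi_mod.
HB.instance Definition _ := gen_choiceMixin pi_mod.

Let add (f g : pi_mod) : pi_mod := fun i => f i + g i.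
Let opp (f : pi_mod) : pi_mod := fun i => - f i.
Let zero : pi_mod := fun i => 0.
Let scale (a : R) (f : pi_mod) : pi_mod := fun i => a *: f i.

Fact pi_addA : associative add.
Proof. by move=> f g h; apply: functional_extensionality_dep => i; exact: addrA. Qed.
Fact pi_addC : commutative add.
Proof. by move=> f g; apply: functional_extensionality_dep => i; exact: addrC. Qed.
Fact pi_add0 : left_id zero add.
Proof. by move=> f; apply: functional_extensionality_dep => i; exact: add0r. Qed.
Fact pi_addN : left_inverse zero opp add.
Proof. by move=> f; apply: functional_extensionality_dep => i; exact: addNr. Qed.

HB.instance Definition _ :=
  GRing.isZmodule.Build pi_mod pi_addA pi_addC pi_add0 pi_addN.

Fact pi_scaleA a b f : scale a (scale b f) = scale (a * b) f.
Proof. by apply: functional_extensionality_dep => i; exact: scalerA. Qed.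
Fact pi_scale1 : left_id 1 scale.
Proof. by move=> f; apply: functional_extensionality_dep => i; exact: scale1r. Qed.
Fact pi_scaleDr : right_distributive scale +%R.
Proof.
by move=> a f g; apply: functional_extensionality_dep => i; exact: scalerDr.
Qed.
Fact pi_scaleDl f : {morph scale^~ f : a b / a + b}.
Proof. by move=> a b; apply: functional_extensionality_dep => i; exact: scalerDl. Qed.

HB.instance Definition _ := GRing.Zmodule_isLmodule.Build R pi_mod
  pi_scaleA pi_scale1 pi_scaleDr pi_scaleDl.

End PiModule.

Section DirectSum.
Context (R : pzRingType) (I : Type) (V : I -> lmodType R).

Definition fin_supp : {pred pi_mod V} :=
  [pred f | `[< finite_set [set i | f i <> 0] >]].

Fact fin_supp_closed : submod_closed fin_supp.
Proof.
split=> [|a f g]; rewrite !inE.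
  by apply: (sub_finite_set (B := set0)) => // i; apply.
move=> Ff Fg.
apply: (@sub_finite_set _ _ ([set i | f i <> 0] `|` [set i | g i <> 0])).
  move=> i /= fg_i; have [f0|] := pselect (f i = 0); last by left.
  by right=> g0; apply: fg_i; rewrite -[LHS]/(a *: f i + g i) f0 g0 scaler0 addr0.
by rewrite finite_setU.
Qed.

Definition dsum := submod fin_supp_closed.

End DirectSum.

Section DirectSumMap.
Context (R : pzRingType) (I : Type) (V W : I -> lmodType R).
Context (f : forall i, {linear V i -> W i}).

Fact dsum_map_subproof (v : dsum V) :
  ((fun i => f i (submod_val v i)) : pi_mod W) \in @fin_supp _ _ W.
Proof.
have := submod_valP v; rewrite !inE => Fv.
by apply: sub_finite_set Fv => i /= fv v0; apply: fv; rewrite v0 linear0.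
Qed.

Definition dsum_map (v : dsum V) : dsum W :=
  Submod (fin_supp_closed W) (dsum_map_subproof v).

Fact dsum_map_linear : linear dsum_map.
Proof.
move=> a u v; apply: val_inj; apply: functional_extensionality_dep => i.
exact: linearP.
Qed.

HB.instance Definition _ :=
  GRing.isLinear.Build R (dsum V) (dsum W) *:%R dsum_map dsum_map_linear.

End DirectSumMap.

Section Dual.
Context (R : comNzRingType) (V : lmodType R).

Definition lin_form : {pred V -> R^o} := [pred f | `[< linear f >]].

Fact lin_form_closed : submod_closed lin_form.
Proof.
split=> [|a f g]; rewrite !inE.
  by move=> b u v; rewrite -[RHS]/(b *: 0 + 0) scaler0 addr0.
move=> Lf Lg b u v.
rewrite !fctE Lf Lg !scalerDr !scalerA (mulrC a b) -!addrA; congr (_ + _).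
by rewrite addrCA.
Qed.

Definition dualmod := submod lin_form_closed.

End Dual.

Section DualMap.
Context (R : comNzRingType) (V W : lmodType R) (f : {linear V -> W}).

Fact dual_map_subproof (xi : dualmod W) :
  ((fun v => submod_val xi (f v)) : V -> R^o) \in @lin_form _ V.
Proof.
have := submod_valP xi; rewrite !inE => L.
by move=> a u v /=; rewrite linearP L.
Qed.

Definition dual_map (xi : dualmod W) : dualmod V :=
  Submod (lin_form_closed V) (dual_map_subproof xi).

Fact dual_map_linear : linear dual_map.
Proof. by move=> a u v; apply: val_inj. Qed.

HB.instance Definition _ :=
  GRing.isLinear.Build R (dualmod W) (dualmod V) *:%R dual_map dual_map_linear.

End DualMap.

Section AlternatingForms.
Context (R : comNzRingType) (n : nat) (V : lmodType R).

Definition upd_at (v : 'I_n -> V) (i : 'I_n) (u : V) : 'I_n -> V :=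
  fun j => if j == i then u else v j.

Definition multilinear (w : ('I_n -> V) -> R^o) :=
  forall v i, linear (fun u => w (upd_at v i u)).

Definition alternating (w : ('I_n -> V) -> R^o) :=
  forall v i j, i != j -> v i = v j -> w v = 0.

Definition alt_form : {pred ('I_n -> V) -> R^o} :=
  [pred w | `[< multilinear w /\ alternating w >]].

Fact alt_form_closed : submod_closed alt_form.
Proof.
split=> [|a f g]; rewrite !inE.
  by split=> // v i b u w ; rewrite -[RHS]/(b *: 0 + 0) scaler0 addr0.
move=> [Lf Af] [Lg Ag]; split.
  move=> v i b u w; rewrite !fctE Lf Lg !scalerDr !scalerA (mulrC a b) -!addrA.
  by congr (_ + _); rewrite addrCA.
by move=> v i j ij vij; rewrite !fctE (Af v i j)// (Ag v i j)// scaler0 addr0.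
Qed.

Definition alt_mod := submod alt_form_closed.

End AlternatingForms.

(* The exterior power of a finite-dimensional V, realized as the module of
   alternating n-forms on the dual of V, where
     (v_1 /\ ... /\ v_n)(xi_1, ..., xi_n) = det (xi_i (v_j)). *)
Definition ext_pow (R : comNzRingType) (n : nat) (V : lmodType R) := alt_mod n (dualmod V).

Section Exterior.
Context (R : comNzRingType) (n : nat) (V W : lmodType R).

Fact wedge_subproof (v : 'I_n -> V) :
  (fun xi : 'I_n -> dualmod V =>
     \det (\matrix_(i, j) (submod_val (xi i) (v j) : R)) : R^o)
    \in @alt_form R n (dualmod V).
Proof.
rewrite inE; split.
  move=> xi i a x y /=.
  rewrite (determinant_multilinear (i0 := i)
    (B := \matrix_(i', j) submod_val (upd_at xi i x i') (v j))
    (C := \matrix_(i', j) submod_val (upd_at xi i y i') (v j))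
    (b := a) (c := 1)) ?mul1r //.
  - by apply/rowP => j; rewrite !mxE /upd_at eqxx mul1r.
  - by apply/matrixP => k j; rewrite !mxE /upd_at eq_sym (negbTE (neq_lift _ _)).
  - by apply/matrixP => k j; rewrite !mxE /upd_at eq_sym (negbTE (neq_lift _ _)).
by move=> xi i j ij e /=; apply: (determinant_alternate ij) => k; rewrite !mxE e.
Qed.

Definition ext_wedge (v : 'I_n -> V) : ext_pow n V :=
  Submod (alt_form_closed n (dualmod V)) (wedge_subproof v).

Context (f : {linear V -> W}).

Fact ext_map_subproof (w : ext_pow n V) :
  ((fun xi => submod_val w (fun i => dual_map f (xi i))) :
    ('I_n -> dualmod W) -> R^o) \in @alt_form R n (dualmod W).
Proof.
have := submod_valP w; rewrite !inE => -[L A]; split.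
  move=> xi i a x y /=.
  have E u : (fun j => dual_map f (upd_at xi i u j))
      = upd_at (fun j => dual_map f (xi j)) i (dual_map f u).
    by apply/funext => j; rewrite /upd_at; case: eqP.
  by rewrite !E linearP L.
by move=> xi i j ij e; apply: (A _ i j) => //; rewrite e.
Qed.

Definition ext_map (w : ext_pow n V) : ext_pow n W :=
  Submod (alt_form_closed n (dualmod W)) (ext_map_subproof w).

Fact ext_map_linear : linear ext_map.
Proof. by move=> a u v; apply: val_inj. Qed.

HB.instance Definition _ :=
  GRing.isLinear.Build R (ext_pow n V) (ext_pow n W) *:%R ext_map ext_map_linear.

End Exterior.

Fact ext_map_wedge (R : comNzRingType) n (V W : lmodType R)
    (f : {linear V -> W}) (v : 'I_n -> V) :
  ext_map f (ext_wedge v) = ext_wedge (f \o v).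
Proof. by apply: val_inj; apply/funext => xi /=; congr (\det _). Qed.

(* The tensor product of finite-dimensional A and B, realized as the module of
   bilinear forms on the duals, where (a (x) b)(xi, eta) = xi(a) eta(b). *)
Section Tensor.
Context (R : comNzRingType) (A B : lmodType R).

Definition bilin_form : {pred dualmod A -> dualmod B -> R^o} :=
  [pred b | `[< (forall eta, linear (b^~ eta)) /\ (forall xi, linear (b xi)) >]].

Fact bilin_form_closed : submod_closed bilin_form.
Proof.
split=> [|a f g]; rewrite !inE.
  by split=> z b u v; rewrite -[RHS]/(b *: 0 + 0) scaler0 addr0.
move=> [Lf Lf'] [Lg Lg'].
by split=> z b u v /=; rewrite !fctE ?Lf ?Lg ?Lf' ?Lg' !scalerDr !scalerA
  (mulrC a b) -!addrA; congr (_ + _); rewrite addrCA.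
Qed.

Definition tensor := submod bilin_form_closed.

Fact pure_subproof (a : A) (b : B) :
  (fun (xi : dualmod A) (eta : dualmod B) =>
    (submod_val xi a : R) * (submod_val eta b : R) : R^o) \in bilin_form.
Proof.
rewrite inE; split=> z c u v /=.
  exact: (etrans (mulrDl _ _ _) (congr1 (+%R^~ _) (esym (mulrA _ _ _)))).
apply: (etrans (mulrDr _ _ _) (congr1 (+%R^~ _) _)).
exact: mulrCA.
Qed.

Definition tensor_pure (a : A) (b : B) : tensor :=
  Submod bilin_form_closed (pure_subproof a b).

End Tensor.

Section TensorMap.
Context (R : comNzRingType) (A B A' B' : lmodType R).
Context (f : {linear A -> A'}) (g : {linear B -> B'}).

Fact tensor_map_subproof (b : tensor A B) :
  (fun xi eta => submod_val b (dual_map f xi) (dual_map g eta))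
    \in @bilin_form R A' B'.
Proof.
have := submod_valP b; rewrite !inE => -[L L'].
by split=> z a u v /=; rewrite linearP ?L ?L'.
Qed.

Definition tensor_map (b : tensor A B) : tensor A' B' :=
  Submod (bilin_form_closed A' B') (tensor_map_subproof b).

Fact tensor_map_pure (a : A) (b : B) :
  tensor_map (tensor_pure a b) = tensor_pure (f a) (g b).
Proof. by apply: val_inj. Qed.

End TensorMap.

Definition is_basis (R : pzRingType) (V : lmodType R) n (e : 'I_n -> V) :=
  forall v, exists! a : 'I_n -> R, v = \sum_k a k *: e k.

Record cochain (R : comNzRingType) := Cochain {
  cterm :> int -> lmodType R ;
  cdiff : forall i, {linear cterm i -> cterm (i + 1)} ;
  cdiff2 : forall i v, cdiff (i + 1) (cdiff i v) = 0 }.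
Arguments cdiff {R} c i.

Record chain_map (R : comNzRingType) (C D : cochain R) := ChainMap {
  cm_fun :> forall i, {linear C i -> D i} ;
  cm_comm : forall i v, cm_fun (i + 1) (cdiff C i v) = cdiff D i (cm_fun i v) }.

Fact cm_comp_subproof (R : comNzRingType) (C D E : cochain R)
    (f : chain_map D E) (g : chain_map C D) i v :
  (f (i + 1) \o g (i + 1)) (cdiff C i v) = cdiff E i ((f i \o g i) v).
Proof. by rewrite /= !cm_comm. Qed.

Definition cm_comp (R : comNzRingType) (C D E : cochain R)
    (f : chain_map D E) (g : chain_map C D) : chain_map C E :=
  ChainMap (cm_fun := fun i => f i \o g i) (cm_comp_subproof f g).

(* f - g = d h + h d in degree i + 1, for every integer i; h i lowers the
   degree from i + 1 to i. *)
Definition homotopic (R : comNzRingType) (C D : cochain R)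
    (f g : chain_map C D) :=
  exists h : forall i, {linear C (i + 1) -> D i}, forall i v,
    f (i + 1) v - g (i + 1) v
    = cdiff D i (h i v) + h (i + 1) (cdiff C (i + 1) v).

Definition mutually_inverse (R : comNzRingType) (C D : cochain R)
    (f : chain_map C D) (f' : chain_map D C) :=
  forall i, cancel (f i) (f' i) /\ cancel (f' i) (f i).

Section Berezinian.
Context (R : comNzRingType).

Definition ev (C : cochain R) := dsum (fun i : int => C (2 * i)).
Definition od (C : cochain R) := dsum (fun i : int => C (2 * i + 1)).

Definition ev_map C D (f : chain_map C D) : {linear ev C -> ev D} :=
  dsum_map (fun i : int => f (2 * i)).
Definition od_map C D (f : chain_map C D) : {linear od C -> od D} :=
  dsum_map (fun i : int => f (2 * i + 1)).

(* p and q stand for the dimensions of the even and the odd part of C. *)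
Definition ber p q (C : cochain R) := tensor (ext_pow p (ev C)) (ext_pow q (dualmod (od C))).

(* The action of an invertible chain map f, with inverse f'. *)
Definition ber_map p q C D (f : chain_map C D) (f' : chain_map D C) :
    ber p q C -> ber p q D :=
  tensor_map (ext_map (ev_map f)) (ext_map (dual_map (od_map f'))).

End Berezinian.

(* Only meant for finite-dimensional V and open U. *)
Fixpoint Ck (R : realType) (V W : normedModType R) (k : nat) (U : set V)
    (f : V -> W) : Prop :=
  match k with
  | 0 => forall x, U x -> {for x, continuous f}
  | k.+1 => (forall x, U x -> differentiable f x) /\
            forall v, Ck k U (fun x => 'D_v f x)
  end.

Definition Cinfty (R : realType) (V W : normedModType R) (U : set V)
    (f : V -> W) := forall k, Ck k U f.

Record chart (R : realType) (T : topologicalType) (n : nat) := Chart {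
  cdom : set T ;
  cfun :> T -> 'rV[R]_n ;
  cinv : 'rV[R]_n -> T ;
  cdom_open : open cdom ;
  cimg_open : open (cfun @` cdom) ;
  cfunK : forall x, cdom x -> cinv (cfun x) = x ;
  cfun_continuous : forall x, cdom x -> {for x, continuous cfun} ;
  cinv_continuous : forall y, (cfun @` cdom) y -> {for y, continuous cinv} }.

Record manifold (R : realType) := Manifold {
  mcarrier :> topologicalType ;
  mdim : nat ;
  atlas : set (chart R mcarrier mdim) ;
  atlas_cover : forall x, exists2 c, atlas c & cdom c x ;
  atlas_compatible : forall c d, atlas c -> atlas d ->
    Cinfty (c @` (cdom c `&` cdom d)) (d \o cinv c) ;
  manifold_hausdorff : hausdorff_space mcarrier ;
  manifold_second_countable : @second_countable mcarrier }.
Arguments atlas {R} m.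

Section SmoothMaps.
Context (R : realType).
Implicit Types M N : manifold R.

Definition smooth_on N (W : set N) (f : N -> R) :=
  forall c, atlas N c -> Cinfty (c @` (cdom c `&` W)) ((f \o cinv c) : _ -> R^o).

Definition smooth_map N M (f : N -> M) :=
  continuous f /\
  forall c d, atlas N c -> atlas M d ->
    Cinfty (c @` (cdom c `&` f @^-1` cdom d)) (d \o f \o cinv c).

Definition submersion N M (f : N -> M) :=
  forall c d x, atlas N c -> atlas M d -> cdom c x -> cdom d (f x) ->
    forall w, exists v, 'd (d \o f \o cinv c) (c x) v = w.

(* Smoothness of a map given on a subset S of N x N (an embedded submanifold in
   the application): it extends, locally in charts, to a smooth map. *)
Definition smooth_on_pairs N M (S : N -> N -> Prop) (f : N -> N -> M) :=
  forall x y, S x y ->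
  forall c c' d, atlas N c -> atlas N c' -> atlas M d ->
    cdom c x -> cdom c' y -> cdom d (f x y) ->
  exists (W : set 'rV[R]_(mdim N + mdim N)) (F : _ -> 'rV[R]_(mdim M)),
    [/\ open W, W (row_mx (c x) (c' y)), Cinfty W F &
      forall x' y', S x' y' -> cdom c x' -> cdom c' y' ->
        W (row_mx (c x') (c' y')) ->
        cdom d (f x' y') /\ d (f x' y') = F (row_mx (c x') (c' y'))].

End SmoothMaps.

Record lframe (R : realType) (M : manifold R) (V : M -> lmodType R) (n : nat) :=
  Frame { fdom : set M ; fsec :> 'I_n -> forall x, V x }.

Record bundle_data (R : realType) (M : manifold R) := BundleData {
  brank : nat ;
  bfiber :> M -> lmodType R ;
  bframes : set (lframe bfiber brank) }.
Arguments bframes {R M} b.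

Section Bundles.
Context (R : realType).
Implicit Types M N : manifold R.

(* Smoothness of a family of maps from the pull-back of E along p to the
   pull-back of F along q: smoothness of its matrices in local frames. *)
Definition smooth_family N M (E F : bundle_data M) (p q : N -> M)
    (Phi : forall z, E (p z) -> F (q z)) :=
  forall e f, bframes E e -> bframes F f ->
  let W := p @^-1` fdom e `&` q @^-1` fdom f in
  exists a : 'I_(brank E) -> 'I_(brank F) -> N -> R,
    (forall j k, smooth_on W (a j k)) /\
    forall z, W z -> forall j,
      Phi z (e j (p z)) = \sum_k a j k z *: f k (q z).

Definition smooth_section M (E : bundle_data M) (U : set M)
    (s : forall x, E x) :=
  forall e, bframes E e ->
  exists a : 'I_(brank E) -> M -> R,
    (forall k, smooth_on (U `&` fdom e) (a k)) /\
    forall x, U x -> fdom e x -> s x = \sum_k a k x *: e k x.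

Definition is_bundle M (E : bundle_data M) :=
  [/\ forall e, bframes E e ->
        open (fdom e) /\ forall x, fdom e x -> is_basis (fun k => e k x),
      forall x, exists2 e, bframes E e & fdom e x &
      @smooth_family M M E E id id (fun _ => id)].

End Bundles.

Record vbundle (R : realType) (M : manifold R) := VBundle {
  vb_data :> bundle_data M ;
  vbP : is_bundle vb_data }.

(* The smooth frames of a direct sum are the frames whose components are smooth
   sections of the summands. *)
Definition dsum_bundle (R : realType) (M : manifold R)
    (E : int -> bundle_data M) : bundle_data M :=
  let V (x : M) : lmodType R := dsum (fun i => E i x) in
  let n := (\big[addn/0]_(i \in [set: int]) brank (E i))%N in
  {| brank := n ;
     bfiber := V ;
     bframes := [set e : lframe V n | [/\ open (fdom e),
       forall x, fdom e x -> is_basis (fun k => e k x) &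
       forall k i, @smooth_section R M (E i) (fdom e)
                     (fun x => submod_val (e k x) i)]] |}.

Record vcomplex (R : realType) (M : manifold R) := VComplex {
  vterm :> int -> vbundle M ;
  vdiff : forall i x, {linear vterm i x -> vterm (i + 1) x} ;
  vdiff2 : forall i x v, vdiff (i + 1) x (vdiff i x v) = 0 ;
  vdiff_smooth : forall i,
    @smooth_family R M M (vterm i) (vterm (i + 1)) id id (vdiff i) ;
  (* A bundle is 0 when its rank is 0. *)
  vbounded : exists N : nat, forall i : int,
    N%:Z < `|i| -> brank (vterm i) = 0%N }.

Definition fiber_complex (R : realType) (M : manifold R) (E : vcomplex M)
    (x : M) : cochain R :=
  @Cochain R (fun i => E i x) (fun i => vdiff E i x)
    (fun i v => @vdiff2 R M E i x v).

Section BerezinianBundle.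
Context (R : realType) (M : manifold R) (E : vcomplex M).

Definition ev_bundle := dsum_bundle (fun i : int => E (2 * i)).
Definition od_bundle := dsum_bundle (fun i : int => E (2 * i + 1)).

Definition ber_fiber (x : M) :=
  ber (brank ev_bundle) (brank od_bundle) (fiber_complex E x).

Definition ber_frame (e : lframe ev_bundle (brank ev_bundle))
    (f' : forall x, 'I_(brank od_bundle) -> dualmod (od_bundle x)) (x : M) :
    ber_fiber x :=
  tensor_pure (ext_wedge (fun k => e k x)) (ext_wedge (f' x)).

(* The frames of Ber(E) are the (e_1 /\ ... /\ e_p) (x) (f^1 /\ ... /\ f^q),
   for smooth frames e of the even part and f of the odd part, f^1, ..., f^q
   being the dual frame of f. *)
Definition ber_bundle : bundle_data M :=
  {| brank := 1 ;
     bfiber := ber_fiber ;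
     bframes := [set b | exists e f f',
       [/\ bframes ev_bundle e, bframes od_bundle f,
           fdom b = fdom e `&` fdom f &
           forall x, fdom b x ->
             (forall j k, submod_val (f' x j) (f k x) = (j == k)%:R) /\
             forall k, b k x = ber_frame e f' x]] |}.

End BerezinianBundle.

(* gmul g h is meaningful only for src g = tgt h. *)
Record lie_groupoid (R : realType) (M : manifold R) := LieGroupoid {
  arrows :> manifold R ;
  src : arrows -> M ;
  tgt : arrows -> M ;
  gunit : M -> arrows ;
  ginv : arrows -> arrows ;
  gmul : arrows -> arrows -> arrows ;
  src_mul : forall g h, src g = tgt h -> src (gmul g h) = src h ;
  tgt_mul : forall g h, src g = tgt h -> tgt (gmul g h) = tgt g ;
  gmulA : forall g h k, src g = tgt h -> src h = tgt k ->
    gmul g (gmul h k) = gmul (gmul g h) k ;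
  src_unit : forall x, src (gunit x) = x ;
  tgt_unit : forall x, tgt (gunit x) = x ;
  unit_mul : forall g, gmul (gunit (tgt g)) g = g ;
  mul_unit : forall g, gmul g (gunit (src g)) = g ;
  src_inv : forall g, src (ginv g) = tgt g ;
  tgt_inv : forall g, tgt (ginv g) = src g ;
  inv_mul : forall g, gmul (ginv g) g = gunit (src g) ;
  mul_inv : forall g, gmul g (ginv g) = gunit (tgt g) ;
  src_smooth : smooth_map src ;
  tgt_smooth : smooth_map tgt ;
  src_submersion : submersion src ;
  tgt_submersion : submersion tgt ;
  unit_smooth : smooth_map gunit ;
  inv_smooth : smooth_map ginv ;
  mul_smooth : smooth_on_pairs (fun g h => src g = tgt h) gmul }.

Section Arrows.
Context (R : realType) (M : manifold R) (G : lie_groupoid M).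

(* Indexing the action of g by its end points x = s(g) and y = t(g) avoids
   transports along the equations s(gh) = s(h) and t(gh) = t(g). *)
Definition garrow (x y : M) := {g : G | src g = x /\ tgt g = y}.

Definition arrow_of (g : G) : garrow (src g) (tgt g) :=
  exist _ g (conj erefl erefl).

Definition arrow_unit (x : M) : garrow x x :=
  exist _ (gunit G x) (conj (src_unit G x) (tgt_unit G x)).

Fact arrow_comp_subproof x y z (g : garrow y z) (h : garrow x y) :
  src (gmul (sval g) (sval h)) = x /\ tgt (gmul (sval g) (sval h)) = z.
Proof.
case: g h => g [sg tg] [h [sh th]] /=.
by rewrite src_mul ?tgt_mul ?sg ?th.
Qed.

Definition arrow_comp x y z (g : garrow y z) (h : garrow x y) : garrow x z :=
  exist _ (gmul (sval g) (sval h)) (arrow_comp_subproof g h).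

End Arrows.

Section Representations.
Context (R : realType) (M : manifold R) (G : lie_groupoid M).

Definition is_representation (L : bundle_data M)
    (Dhat : forall x y, garrow G x y -> L x -> L y) :=
  [/\ is_bundle L /\ brank L = 1%N,
      forall x y (g : garrow G x y), linear (Dhat x y g) /\ bijective (Dhat x y g),
      forall x y z (g : garrow G y z) (h : garrow G x y),
        Dhat x z (arrow_comp g h) = Dhat y z g \o Dhat x y h &
      @smooth_family R G M L L (@src R M G) (@tgt R M G)
        (fun g => Dhat _ _ (arrow_of g))].

Record weak_representation (E : vcomplex M) := WeakRepresentation {
  wact : forall x y, garrow G x y ->
    chain_map (fiber_complex E x) (fiber_complex E y) ;
  wact_comp : forall x y z (g : garrow G y z) (h : garrow G x y),
    homotopic (cm_comp (wact g) (wact h)) (wact (arrow_comp g h)) ;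
  wact_smooth : forall i,
    @smooth_family R G M (E i) (E i) (@src R M G) (@tgt R M G)
      (fun g => wact (arrow_of g) i) }.

Definition unital (E : vcomplex M) (Delta : weak_representation E) :=
  forall x i v, wact Delta (arrow_unit G x) i v = v.

(* How Delta induces Dhat: every Delta_g is homotopic to an invertible chain
   map, and Dhat_g is the action on Berezinians of any such map. *)
Definition induced_by (E : vcomplex M) (Delta : weak_representation E)
    (Dhat : forall x y, garrow G x y -> ber_bundle E x -> ber_bundle E y) :=
  forall x y (g : garrow G x y),
    (exists f f', mutually_inverse f f' /\ homotopic (wact Delta g) f) /\
    forall f f', mutually_inverse f f' -> homotopic (wact Delta g) f ->
      Dhat x y g = @ber_map R _ _ _ _ f f'.

End Representations.

(* Main.v *)
(** Since Delta_(g^-1) is a homotopy inverse of Delta_g and the fibres of E at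
    s(g) and t(g) have equal ranks in each degree, Delta_g is homotopic to an
    isomorphism f: choose contractions p on both sides; f is q Delta_g q on the
    harmonic parts, where q = 1 - dp - pd, and the acyclic parts are matched by
    dimension count.  The Berezinian of f depends only on the homotopy class:
    if f - 1 = dh + hd, then on each of the even and odd parts f is
    (1 + hd)(1 + dh), because dd = 0, and det (1 + AB) = det (1 + BA) makes the
    two determinants equal.  Smoothness near g0: if f - Delta_g0 = dh + hd,
    then Delta_g + dh + hd, with h constant in local frames, is a smooth family
    of chain maps homotopic to Delta_g and still invertible near g0; its action
    on Berezinians is, in frames, a quotient of two determinants. *)

From HB Require Import structures.
Require Import Defs.
From mathcomp Require Import all_boot all_order all_algebra.
From mathcomp Require Import fingroup perm.
From mathcomp Require Import zify.
From mathcomp Require Import all_classical all_reals all_analysis.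

Set Implicit Arguments.
Unset Strict Implicit.
Unset Printing Implicit Defensive.

Import Order.TTheory GRing.Theory Num.Theory.
Import numFieldNormedType.Exports.

Local Open Scope classical_set_scope.
Local Open Scope ring_scope.

(** * Coordinates and traces *)

(** The rank of the differential may jump from fibre to fibre, so contractions, harmonic parts and
    isomorphisms need not vary smoothly; they are chosen separately for each arrow. Independence of
    the choice is therefore needed for smoothness too: near a given arrow the same map of lines may
    be computed with any family of isomorphisms that is smooth there. To produce one, the homotopy
    is carried to nearby arrows and not the isomorphism: an isomorphism extended with constant
    coefficients would stop commuting with the differentials, whereas a homotopy has no equation to
    satisfy. Dimensions are compared through traces of idempotents. Traces are additive, cyclic even
    between different spaces, and in characteristic zero they determine the rank; this is why number
    fields appear among the hypotheses. *)

Definition lin_pack (R : pzRingType) (V W : lmodType R) (f : V -> W)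
  (lf : linear f) : {linear V -> W} :=
  HB.pack f (GRing.isLinear.Build R V W *:%R f lf).

Section Coordinates.
Context (R : comNzRingType).
Implicit Types V W X : lmodType R.

Definition coords V n (e : 'I_n -> V) (v : V) : 'rV[R]_n :=
  xget 0 [set a : 'rV[R]_n | v = \sum_k a 0 k *: e k].

Lemma coordsE V n (e : 'I_n -> V) (v : V) : is_basis e ->
  v = \sum_k coords e v 0 k *: e k.
Proof.
move=> /(_ v) [a [va _]]; rewrite /coords; case: xgetP => //= /(_ (\row_k a k)).
by case; rewrite {1}va; apply: eq_bigr => k _; rewrite mxE.
Qed.

Lemma basis_inj V n (e : 'I_n -> V) (a b : 'I_n -> R) : is_basis e ->
  \sum_k a k *: e k = \sum_k b k *: e k -> a =1 b.
Proof.
move=> /(_ (\sum_k a k *: e k)) [c [_ cu]] ab k.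
by rewrite -(cu a erefl) -(cu b ab).
Qed.

Lemma coords_uniq V n (e : 'I_n -> V) (v : V) (a : 'rV[R]_n) : is_basis e ->
  v = \sum_k a 0 k *: e k -> coords e v = a.
Proof.
move=> be va; apply/rowP; apply: (basis_inj be).
by rewrite -coordsE.
Qed.

Lemma coords_linear V n (e : 'I_n -> V) : is_basis e -> linear (coords e).
Proof.
move=> be a u v; apply: coords_uniq => //.
rewrite [in LHS](coordsE u be) [in LHS](coordsE v be) scaler_sumr -big_split/=.
by apply: eq_bigr => k _; rewrite !mxE scalerDl scalerA.
Qed.

Lemma coords_basis V n (e : 'I_n -> V) j : is_basis e ->
  coords e (e j) = delta_mx 0 j.
Proof.
move=> be; apply: coords_uniq => //.
rewrite (bigD1 j)//= mxE !eqxx scale1r big1 ?addr0// => k kj.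
by rewrite mxE eqxx (negbTE kj) scale0r.
Qed.

Lemma linear_basis_eq V W n (e : 'I_n -> V) (f g : {linear V -> W}) :
  is_basis e -> (forall k, f (e k) = g (e k)) -> f =1 g.
Proof.
move=> be fg v; rewrite (coordsE v be) !linear_sum.
by apply: eq_bigr => k _; rewrite !linearZ fg.
Qed.

(** Row convention: row [j] holds the coordinates of [phi (e j)], so that composition becomes the
    matrix product in reversed order. *)
Definition mxof V W m n (e : 'I_m -> V) (f : 'I_n -> W) (phi : V -> W) :
  'M[R]_(m, n) := \matrix_(j, k) coords f (phi (e j)) 0 k.

Lemma mxofE V W m n (e : 'I_m -> V) (f : 'I_n -> W) (phi : V -> W) j :
  is_basis f -> phi (e j) = \sum_k mxof e f phi j k *: f k.
Proof.
by move=> bf; rewrite [LHS](coordsE _ bf); apply: eq_bigr => k _; rewrite mxE.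
Qed.

Lemma mxof_uniq V W m n (e : 'I_m -> V) (f : 'I_n -> W) (phi : V -> W) (A : 'M[R]_(m, n)) :
  is_basis f -> (forall j, phi (e j) = \sum_k A j k *: f k) ->
  mxof e f phi = A.
Proof.
move=> bf phiA; apply/matrixP => j k; rewrite mxE.
rewrite (coords_uniq (a := row j A) bf) ?mxE// phiA.
by apply: eq_bigr => i _; rewrite mxE.
Qed.

Lemma eq_mxof V W m n (e : 'I_m -> V) (f : 'I_n -> W) (phi psi : V -> W) :
  phi =1 psi -> mxof e f phi = mxof e f psi.
Proof. by move=> pp; apply/matrixP => j k; rewrite !mxE pp. Qed.

Lemma mxof_comp V W X m n p (e : 'I_m -> V) (f : 'I_n -> W) (g : 'I_p -> X)
    (phi : V -> W) (psi : {linear W -> X}) : is_basis f -> is_basis g ->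
  mxof e g (psi \o phi) = mxof e f phi *m mxof f g psi.
Proof.
move=> bf bg; apply: mxof_uniq => // j /=.
rewrite (mxofE e phi j bf) linear_sum.
transitivity (\sum_i \sum_k mxof e f phi j i *: (mxof f g psi i k *: g k)).
  by apply: eq_bigr => i _; rewrite linearZ/= (mxofE f psi _ bg) scaler_sumr.
rewrite exchange_big/=; apply: eq_bigr => k _; rewrite mxE scaler_suml.
by apply: eq_bigr => i _; rewrite scalerA.
Qed.

Lemma mxof_id V n (e : 'I_n -> V) : is_basis e -> mxof e e id = 1%:M.
Proof.
move=> be; apply: mxof_uniq => // j.
rewrite (bigD1 j)//= mxE eqxx scale1r big1 ?addr0// => k kj.
by rewrite mxE eq_sym (negbTE kj) scale0r.
Qed.

Lemma mxofD V W m n (e : 'I_m -> V) (f : 'I_n -> W) (phi psi : V -> W) :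
  is_basis f -> mxof e f (phi \+ psi) = mxof e f phi + mxof e f psi.
Proof.
move=> bf; apply: mxof_uniq => // j /=.
rewrite (mxofE e phi j bf) (mxofE e psi j bf) -big_split/=.
by apply: eq_bigr => k _; rewrite [in RHS]mxE scalerDl.
Qed.

Lemma mxof_cancel V W n (e : 'I_n -> V) (f : 'I_n -> W) (phi : V -> W)
    (psi : {linear W -> V}) : is_basis e -> is_basis f ->
  cancel phi psi -> mxof e f phi *m mxof f e psi = 1%:M.
Proof.
move=> be bf K; rewrite -mxof_comp// -(mxof_id be).
by apply: eq_mxof => v /=.
Qed.

Lemma linear_of_mx V W m n (e : 'I_m -> V) (f : 'I_n -> W) (A : 'M[R]_(m, n)) :
  is_basis e ->
  {phi : {linear V -> W} | forall j, phi (e j) = \sum_k A j k *: f k}.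
Proof.
move=> be; pose phi v : W := \sum_k (coords e v *m A) 0 k *: f k.
have lphi : linear phi.
  move=> a u v; rewrite /phi (coords_linear be) mulmxDl -scalemxAl.
  rewrite scaler_sumr -big_split/=; apply: eq_bigr => k _.
  by rewrite !mxE scalerDl scalerA.
exists (lin_pack lphi) => j /=; rewrite /phi; apply: eq_bigr => k _.
by rewrite coords_basis// -rowE mxE.
Qed.

Definition ltrace V n (e : 'I_n -> V) (phi : V -> V) : R := \tr (mxof e e phi).

Lemma ltraceC V W m n (e : 'I_m -> V) (f : 'I_n -> W) (phi : {linear V -> W})
    (psi : {linear W -> V}) : is_basis e -> is_basis f ->
  ltrace e (psi \o phi) = ltrace f (phi \o psi).
Proof.
move=> be bf; rewrite /ltrace (mxof_comp e phi psi bf be).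
by rewrite (mxof_comp f psi phi be bf) mxtrace_mulC.
Qed.

Lemma ltraceD V n (e : 'I_n -> V) (phi psi : V -> V) : is_basis e ->
  ltrace e (phi \+ psi) = ltrace e phi + ltrace e psi.
Proof. by move=> be; rewrite /ltrace mxofD// mxtraceD. Qed.

Lemma ltrace_id V n (e : 'I_n -> V) : is_basis e -> ltrace e id = n%:R.
Proof. by move=> be; rewrite /ltrace mxof_id// mxtrace1. Qed.

Lemma eq_ltrace V n (e : 'I_n -> V) (phi psi : V -> V) : phi =1 psi ->
  ltrace e phi = ltrace e psi.
Proof. by move=> pp; rewrite /ltrace (eq_mxof _ _ pp). Qed.

Definition ldet V n (e : 'I_n -> V) (phi : V -> V) : R := \det (mxof e e phi).

Lemma eq_ldet V n (e : 'I_n -> V) (phi psi : V -> V) : phi =1 psi ->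
  ldet e phi = ldet e psi.
Proof. by move=> pp; rewrite /ldet (eq_mxof _ _ pp). Qed.

Lemma ldet_comp V n (e : 'I_n -> V) (phi psi : {linear V -> V}) : is_basis e ->
  ldet e (psi \o phi) = ldet e psi * ldet e phi.
Proof. by move=> be; rewrite /ldet (mxof_comp e phi psi be be) det_mulmx mulrC. Qed.

(** Sylvester's identity. Multiplying [P] by one and the same unitriangular matrix, on the right or
    on the left, gives block lower triangular matrices whose determinants are the two sides. *)
Lemma det_add1_mulC m n (A : 'M[R]_(m, n)) (B : 'M[R]_(n, m)) :
  \det (1%:M + A *m B) = \det (1%:M + B *m A).
Proof.
pose P := block_mx 1%:M (- A) B (1%:M : 'M[R]_n).
have P1 : P *m block_mx 1%:M A 0 1%:M = block_mx 1%:M 0 B (1%:M + B *m A).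
  rewrite /P mulmx_block !mulmx1 !mulmx0 !mul1mx !addr0 subrr.
  by rewrite addrC.
have P2 : block_mx 1%:M A 0 1%:M *m P = block_mx (1%:M + A *m B) 0 B 1%:M.
  by rewrite /P mulmx_block !mulmx1 !mul0mx !mul1mx !add0r addNr.
have := congr1 determinant P1; rewrite det_mulmx det_ublock !det1 mul1r mulr1.
rewrite det_lblock det1 mul1r => <-.
have := congr1 determinant P2; rewrite det_mulmx det_ublock !det1 !mul1r.
by rewrite det_lblock det1 mulr1 => <-.
Qed.

Lemma ldet_add1_mulC V W m n (e : 'I_m -> V) (f : 'I_n -> W)
    (phi : {linear V -> W}) (psi : {linear W -> V}) :
  is_basis e -> is_basis f ->
  ldet e (fun v => v + psi (phi v)) = ldet f (fun w => w + phi (psi w)).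
Proof.
move=> be bf; rewrite /ldet.
have -> : mxof e e (fun v => v + psi (phi v)) = 1%:M + mxof e f phi *m mxof f e psi.
  by rewrite -mxof_comp// -(mxof_id be) -mxofD.
have -> : mxof f f (fun v => v + phi (psi v)) = 1%:M + mxof f e psi *m mxof e f phi.
  by rewrite -mxof_comp// -(mxof_id bf) -mxofD.
exact: det_add1_mulC.
Qed.

End Coordinates.

(** * Idempotents and generalized inverses over a field *)

Section IdempotentMatrices.
Context (F : fieldType).

(** In the rank factorization [e = c r], idempotence reads [c (r c) r = c r]; then [c] cancels on
    the left and [r] on the right. *)
Lemma idempotent_mx_split n (e : 'M[F]_n) : e *m e = e ->
  {c : 'M[F]_(n, \rank e) & {r : 'M[F]_(\rank e, n) | c *m r = e & r *m c = 1%:M}}.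
Proof.
move=> ee; exists (col_base e), (row_base e); first exact: mulmx_base.
apply: (row_full_inj (col_base_full e)).
apply: (@row_free_inj _ _ _ _ (row_base e)); first exact: row_base_free.
by rewrite mulmx1 mulmxA mulmx_base -mulmxA mulmx_base.
Qed.

(** It replaces ranks by traces, which are additive and cyclic. *)
Lemma idempotent_mx_trace n (e : 'M[F]_n) : e *m e = e -> \tr e = (\rank e)%:R.
Proof.
move=> /idempotent_mx_split[c [r cr rc]].
by rewrite -{1}cr mxtrace_mulC rc mxtrace1.
Qed.

End IdempotentMatrices.

(** In characteristic zero equal traces mean equal ranks; the two rank factorizations are then
    combined crosswise. *)
Lemma idempotent_mx_equiv (F : numFieldType) m n (e : 'M[F]_m) (e' : 'M[F]_n) :
  e *m e = e -> e' *m e' = e' -> \tr e = \tr e' ->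
  exists (a : 'M[F]_(m, n)) (b : 'M[F]_(n, m)), a *m b = e /\ b *m a = e'.
Proof.
move=> ee ee'; rewrite !idempotent_mx_trace// => /eqP; rewrite eqr_nat => /eqP.
have [c [r cr rc]] := idempotent_mx_split ee.
have [c' [r' cr' rc']] := idempotent_mx_split ee'.
move: (\rank e) (\rank e') c r cr c' r' cr' rc rc'.
move=> k k' c r cr c' r' cr' rc rc' kk'; subst k'; exists (c *m r'), (c' *m r).
by rewrite !mulmxA -(mulmxA c) rc' mulmx1 -(mulmxA c') rc mulmx1.
Qed.

Lemma generalized_inverse (F : fieldType) (V W : lmodType F) m n
    (e : 'I_m -> V) (f : 'I_n -> W) (phi : {linear V -> W}) :
  is_basis e -> is_basis f ->
  exists psi : {linear W -> V}, forall v, phi (psi (phi v)) = phi v.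
Proof.
move=> be bf; pose A := mxof e f phi.
have [psi psiE] := linear_of_mx e (pinvmx A) bf.
exists psi => v.
suff : (phi \o psi \o phi) =1 phi by apply.
apply: (linear_basis_eq be) => k.
rewrite [LHS](mxofE e (phi \o psi \o phi) k bf) [RHS](mxofE e phi k bf).
suff -> : mxof e f (phi \o psi \o phi) = A by [].
rewrite (mxof_comp e phi (phi \o psi) bf bf) (mxof_comp f psi phi be bf).
by rewrite (mxof_uniq be psiE) mulmxA mulmxKpV.
Qed.

(** An isomorphism between the images of [a] and [b], presented as two maps of the whole spaces that
    vanish on the kernels. Precomposing arbitrary lifts with [a] and [b] secures the vanishing. *)
Lemma idempotent_equiv (F : numFieldType) (V W : lmodType F) m n
    (e : 'I_m -> V) (f : 'I_n -> W) (a : {linear V -> V}) (b : {linear W -> W}) :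
  is_basis e -> is_basis f -> (forall v, a (a v) = a v) ->
  (forall w, b (b w) = b w) -> ltrace e a = ltrace f b ->
  exists (k : {linear V -> W}) (k' : {linear W -> V}),
    [/\ forall v, k' (k v) = a v, forall w, k (k' w) = b w,
        forall v, k (a v) = k v & forall w, k' (b w) = k' w].
Proof.
move=> be bf aa bb trab.
have Ma : mxof e e a *m mxof e e a = mxof e e a.
  by rewrite -mxof_comp//; apply: eq_mxof.
have Mb : mxof f f b *m mxof f f b = mxof f f b.
  by rewrite -mxof_comp//; apply: eq_mxof.
have [A [B [AB BA]]] := idempotent_mx_equiv Ma Mb trab.
have [k0 k0E] := linear_of_mx f A be.
have [k1 k1E] := linear_of_mx e B bf.
have k1k0 : k1 \o k0 =1 a.
  apply: (linear_basis_eq be) => k; rewrite [LHS](mxofE e (k1 \o k0) k be).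
  by rewrite [RHS](mxofE e a k be) (mxof_comp e k0 k1 bf be)
    (mxof_uniq bf k0E) (mxof_uniq be k1E) AB.
have k0k1 : k0 \o k1 =1 b.
  apply: (linear_basis_eq bf) => k; rewrite [LHS](mxofE f (k0 \o k1) k bf).
  by rewrite [RHS](mxofE f b k bf) (mxof_comp f k1 k0 be bf)
    (mxof_uniq bf k0E) (mxof_uniq be k1E) BA.
have k0a v : k0 (a v) = b (k0 v) by rewrite -k1k0 -k0k1.
have k1b w : k1 (b w) = a (k1 w) by rewrite -k1k0 -k0k1.
exists (k0 \o a), (k1 \o b); split=> [v|w|v|w] /=.
- by rewrite k1b [k1 _]k1k0 !aa.
- by rewrite k0a [k0 _]k0k1 !bb.
- by rewrite aa.
- by rewrite bb.
Qed.

(** * Top exterior powers and tensor products of lines *)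

Section TopForms.
Context (R : comNzRingType) (W : lmodType R) (n : nat).
Implicit Type w : alt_mod n W.

Lemma alt_modP w : multilinear (submod_val w) /\ Defs.alternating (submod_val w).
Proof. by have := submod_valP w; rewrite inE. Qed.

Lemma eq_alt_mod w w' : submod_val w =1 submod_val w' -> w = w'.
Proof. by move=> ww; apply: val_inj; apply/funext. Qed.

Lemma upd_at_id (v : 'I_n -> W) i : upd_at v i (v i) = v.
Proof. by apply/funext => j; rewrite /upd_at; case: eqP => [->|]. Qed.

(** Polarization: the form vanishes when [v i + v j] stands in both slots; expanding leaves the two
    mixed terms. *)
Lemma alt_mod_tperm w (v : 'I_n -> W) i j : i != j ->
  submod_val w (v \o tperm i j) = - submod_val w v.
Proof.
move=> ij; have [L A] := alt_modP w.
pose u x y := upd_at (upd_at v i x) j y.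
have u0 x : submod_val w (u x x) = 0.
  by apply: (A _ i j ij); rewrite /u /upd_at !eqxx (negbTE ij).
have uC x y : u x y = upd_at (upd_at v j y) i x.
  apply/funext => k; rewrite /u /upd_at.
  by case: (k =P j) => // ->; rewrite eq_sym (negbTE ij).
have uD2 x y z : submod_val w (u x (y + z)) =
    submod_val w (u x y) + submod_val w (u x z).
  by rewrite -[y]scale1r /u L !scale1r.
have uD1 x y z : submod_val w (u (x + y) z) =
    submod_val w (u x z) + submod_val w (u y z).
  by rewrite -[x]scale1r !uC L !scale1r.
have := u0 (v i + v j); rewrite uD1 !uD2 !u0 add0r addr0 => /eqP.
rewrite addr_eq0 => /eqP; have <- : v \o tperm i j = u (v j) (v i).
  apply/funext => k; rewrite /u /upd_at /=.
  case: (k =P j) => [->|/eqP kj]; first by rewrite tpermR.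
  case: (k =P i) => [->|/eqP ki]; first by rewrite tpermL.
  by rewrite tpermD// eq_sym.
by rewrite /u !upd_at_id => ->; rewrite opprK.
Qed.

(** Only vanishing is followed through the transpositions, so the sign of [s] never has to be
    computed. *)
Lemma alt_mod_perm w (v : 'I_n -> W) (s : 'S_n) :
  submod_val w v = 0 -> submod_val w (v \o s) = 0.
Proof.
move=> v0; have [ts -> _] := prod_tpermP s.
elim: ts v v0 => [|[i j] ts IH] v v0.
  rewrite big_nil; suff -> : v \o (1 : 'S_n)%g = v by [].
  by apply/funext => k; rewrite /= perm1.
rewrite big_cons /=.
have -> : v \o (tperm i j * \prod_(t <- ts) tperm t.1 t.2)%g =
    (v \o (\prod_(t <- ts) tperm t.1 t.2)%g) \o tperm i j.
  by apply/funext => k; rewrite /= permM.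
have [->|ij] := eqVneq i j; last by rewrite alt_mod_tperm// IH// oppr0.
rewrite tperm1; suff -> : forall u : 'I_n -> W, u \o (1 : 'S_n)%g = u by exact: IH.
by move=> u; apply/funext => k; rewrite /= perm1.
Qed.

Lemma multilinear_sum (w : ('I_n -> W) -> R^o) v i m (a : 'I_m -> R) e :
  multilinear w ->
  w (upd_at v i (\sum_k a k *: e k)) = \sum_k a k * w (upd_at v i (e k)).
Proof.
move=> L; rewrite -[LHS]/(lin_pack (L v i) _) linear_sum.
by apply: eq_bigr => k _; rewrite linearZ.
Qed.

(* A multilinear form vanishing on all tuples of basis vectors is zero: expand
   the arguments one at a time. *)
Lemma alt_mod_basis0 w (e : 'I_n -> W) : is_basis e ->
  submod_val w e = 0 -> w = 0.
Proof.
move=> be we; have [L A] := alt_modP w.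
have wes (s : 'I_n -> 'I_n) : submod_val w (e \o s) = 0.
  have [/injectiveP sI|/injectivePn[i [j ij sij]]] := boolP (injectiveb s).
    suff -> : e \o s = e \o perm sI by exact: alt_mod_perm.
    by apply/funext => k; rewrite /= permE.
  by apply: (A _ i j ij); rewrite /= sij.
apply: eq_alt_mod => v; rewrite [RHS]/=.
suff : forall m, (m <= n)%N -> forall u : 'I_n -> W,
    (forall i : 'I_n, (m <= i)%N -> exists k, u i = e k) -> submod_val w u = 0.
  by move=> /(_ n (leqnn n) v); apply => i; rewrite leqNgt ltn_ord.
elim=> [_ u ue|m IH mn u ue].
  have [s us] := choice (fun i => ue i (leq0n i)).
  by rewrite (_ : u = e \o s) ?wes//; apply/funext => i; rewrite us.
pose i := Ordinal mn; rewrite -(upd_at_id u i) (coordsE (u i) be).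
rewrite (multilinear_sum _ _ _ _ L) big1// => k _.
rewrite IH ?mulr0// 1?ltnW// => j; rewrite /upd_at leq_eqVlt => /orP[|mj].
  by move=> /eqP mj; rewrite ifT; [exists k|apply/eqP/val_inj].
rewrite ifF; first by apply: ue.
by apply/eqP => ji; move: mj; rewrite ji ltnn.
Qed.

End TopForms.

Definition dual_family (R : comNzRingType) (V : lmodType R) n
    (e : 'I_n -> V) (e' : 'I_n -> dualmod V) :=
  forall j k, submod_val (e' j) (e k) = (j == k)%:R.

Section Duals.
Context (R : comNzRingType) (V : lmodType R) (n : nat).
Implicit Types (e : 'I_n -> V).

Lemma dualmod_linear (xi : dualmod V) : linear (submod_val xi).
Proof. by have := submod_valP xi; rewrite inE. Qed.

Lemma dualmod_sum (xi : dualmod V) m (a : 'I_m -> R) (u : 'I_m -> V) :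
  submod_val xi (\sum_k a k *: u k) = \sum_k a k * (submod_val xi (u k) : R).
Proof.
rewrite -[LHS]/(lin_pack (dualmod_linear xi) _) linear_sum.
by apply: eq_bigr => k _; rewrite linearZ.
Qed.

Lemma sum_dualmod (v : V) m (a : 'I_m -> R) (u : 'I_m -> dualmod V) :
  submod_val (\sum_k a k *: u k) v = \sum_k a k * (submod_val (u k) v : R).
Proof.
rewrite -[LHS]/((fun xi : dualmod V => submod_val xi v : R) _).
by elim/big_rec2: _ => [//|k y x _ <-].
Qed.

Lemma dual_family_exists e : is_basis e -> {e' : 'I_n -> dualmod V | dual_family e e'}.
Proof.
move=> be; have lc j : linear (fun v => coords e v 0 j : R^o).
  by move=> a u v; rewrite (coords_linear be) !mxE.
have lc' j : (fun v => coords e v 0 j : R^o) \in @lin_form R V by rewrite inE.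
exists (fun j => Submod (lin_form_closed V) (lc' j)) => j k /=.
by rewrite coords_basis// mxE eqxx.
Qed.

Lemma dual_family_coords e (e' : 'I_n -> dualmod V) v j : is_basis e -> dual_family e e' ->
  submod_val (e' j) v = coords e v 0 j.
Proof.
move=> be d; rewrite {1}(coordsE v be) dualmod_sum (bigD1 j)//= d eqxx mulr1.
by rewrite big1 ?addr0// => k kj; rewrite d eq_sym (negbTE kj) mulr0.
Qed.

Lemma dual_family_expand e (e' : 'I_n -> dualmod V) (xi : dualmod V) :
  is_basis e -> dual_family e e' ->
  xi = \sum_k (submod_val xi (e k) : R) *: e' k.
Proof.
move=> be d; apply: val_inj; apply/funext => v /=.
rewrite sum_dualmod {1}(coordsE v be) dualmod_sum; apply: eq_bigr => k _.
by rewrite (dual_family_coords _ _ be d) mulrC.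
Qed.

Lemma dual_basis e (e' : 'I_n -> dualmod V) : is_basis e -> dual_family e e' -> is_basis e'.
Proof.
move=> be d xi; exists (fun k => submod_val xi (e k)); split.
  exact: dual_family_expand.
move=> a ->; apply/funext => j; rewrite sum_dualmod (bigD1 j)//= d eqxx mulr1.
by rewrite big1 ?addr0// => k kj; rewrite d (negbTE kj) mulr0.
Qed.

End Duals.

Section Wedge.
Context (R : comNzRingType) (V : lmodType R) (n : nat).

Lemma wedge_dual (e : 'I_n -> V) e' : dual_family e e' ->
  submod_val (ext_wedge e) e' = 1.
Proof.
move=> d /=; rewrite (_ : \matrix_(_, _) _ = 1%:M) ?det1//.
by apply/matrixP => i j; rewrite !mxE d.
Qed.

(** The top exterior power is a line: both sides agree on the single tuple [e'], a basis of the
    dual, and a top alternating form is determined by its value there. *)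
Lemma ext_pow_wedge (e : 'I_n -> V) e' (w : ext_pow n V) :
  is_basis e -> dual_family e e' -> w = (submod_val w e' : R) *: ext_wedge e.
Proof.
move=> be d; apply/eqP; rewrite -subr_eq0; apply/eqP.
apply: (alt_mod_basis0 (dual_basis be d)).
rewrite -[LHS]/((submod_val w e' : R) -
  (submod_val w e' : R) * (submod_val (ext_wedge e) e' : R)).
by rewrite wedge_dual// mulr1 subrr.
Qed.

Lemma wedge_lin_comb (e u : 'I_n -> V) (A : 'M[R]_n) :
  (forall j, u j = \sum_k A j k *: e k) ->
  ext_wedge u = \det A *: ext_wedge e.
Proof.
move=> uA; apply: eq_alt_mod => xi.
rewrite -[RHS]/(\det A * (submod_val (ext_wedge e) xi : R)) /=.
rewrite -[\det A]det_tr mulrC -det_mulmx; congr (\det _).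
apply/matrixP => i j; rewrite !mxE uA dualmod_sum; apply: eq_bigr => k _.
by rewrite !mxE mulrC.
Qed.

End Wedge.

Section TensorPure.
Context (R : comNzRingType) (A B : lmodType R).

Lemma tensor_pureZ (a : A) (b : B) (x y : R) :
  tensor_pure (x *: a) (y *: b) = (x * y) *: tensor_pure a b.
Proof.
apply: val_inj; apply/funext => xi; apply/funext => eta /=.
have Z (C : lmodType R) (z : dualmod C) (c : C) (t : R) :
    submod_val z (t *: c) = t * (submod_val z c : R).
  by rewrite -[LHS]/(lin_pack (dualmod_linear z) _) linearZ.
by rewrite !Z mulrACA.
Qed.

(** The hypotheses make [al] and [be] coordinate functionals of lines spanned by [a] and [b]. Dually
    they span all functionals, so a bilinear form is known from its value at [al] and [be]. *)
Lemma tensor_pure_expand (a : A) (b : B) (t : tensor A B)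
    (al : dualmod A) (be : dualmod B) :
  (forall u, u = (submod_val al u : R) *: a) ->
  (forall u, u = (submod_val be u : R) *: b) ->
  t = (submod_val t al be : R) *: tensor_pure a b.
Proof.
move=> ha hb; have := submod_valP t; rewrite inE => -[L L'].
apply: val_inj; apply/funext => xi; apply/funext => eta.
have X (C : lmodType R) (c : C) (ga z : dualmod C) : (forall u, u = (submod_val ga u : R) *: c) ->
    z = (submod_val z c : R) *: ga.
  move=> h; apply: val_inj; apply/funext => u; rewrite [in LHS](h u).
  rewrite -[LHS]/(lin_pack (dualmod_linear z) _) linearZ.
  exact: mulrC.
rewrite {1}(X _ _ _ xi ha) {1}(X _ _ _ eta hb).
rewrite -[LHS]/(lin_pack (L _) _) linearZ.
rewrite -[X in _ *: X = _]/(lin_pack (L' _) _) linearZ.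
rewrite -[RHS]/((submod_val t al be : R) *
  ((submod_val xi a : R) * (submod_val eta b : R))).
by rewrite -[LHS]/((submod_val xi a : R) * ((submod_val eta b : R) *
  (submod_val t al be : R))) mulrA mulrC.
Qed.

End TensorPure.

(** * Finite direct sums and parity *)

(** A numbering of the pairs (summand, basis index), that is, of a basis of the direct sum. *)
Definition dsum_index (I : choiceType) (n : I -> nat) N
    (phi : 'I_N -> {i : I & 'I_(n i)}) (psi : {i : I & 'I_(n i)} -> 'I_N) :=
  cancel phi psi /\ cancel psi phi.

Lemma dsum_index_exists (I : choiceType) (n : I -> nat) :
  finite_set [set i | n i <> 0%N] ->
  exists phi psi,
    @dsum_index I n (\big[addn/0]_(i \in [set: I]) n i)%N phi psi.
Proof.
move=> finn; set s := finite_support 0%N [set: I] n.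
have sP i : n i <> 0%N -> i \in s.
  move=> ni; rewrite in_finite_support; first by rewrite inE.
  by apply: sub_finite_set finn => j [].
pose L := [seq Tagged (fun i => 'I_(n i)) j | i <- s, j <- enum 'I_(n i)].
have L_uniq : uniq L.
  apply: allpairs_uniq_dep => [|i _|[i j] [i' j'] _ _ //=].
    exact: finite_support_uniq.
  exact: enum_uniq.
have mem_L t : t \in L.
  case: t => i j; apply/allpairsPdep; exists i, j; split; last by [].
    by apply: sP => n0; case: j => k; rewrite n0.
  by rewrite mem_enum.
have sizeL : size L = (\big[addn/0]_(i \in [set: I]) n i)%N.
  rewrite size_allpairs_dep sumnE big_map; apply: eq_bigr => i _.
  by rewrite size_enum_ord.
rewrite -sizeL; exists (tnth (in_tuple L)).
exists (fun t => Ordinal (etrans (index_mem t L) (mem_L t))); split=> t.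
  apply: val_inj; rewrite /= (tnth_nth (tnth (in_tuple L) t)) /=.
  by rewrite index_uniq.
by rewrite (tnth_nth t) /= nth_index.
Qed.

Section DsumBasis.
Context (R : comNzRingType) (I : choiceType) (V : I -> lmodType R).
Implicit Types v w : dsum V.

Lemma eq_dsum v w : (forall i, submod_val v i = submod_val w i) -> v = w.
Proof. by move=> vw; apply: val_inj; apply: functional_extensionality_dep. Qed.

Lemma dsum_val_sum m (a : 'I_m -> R) (u : 'I_m -> dsum V) i :
  submod_val (\sum_k a k *: u k) i = \sum_k a k *: submod_val (u k) i.
Proof.
rewrite -[LHS]/((fun v => submod_val v i) _).
by elim/big_rec2: _ => [//|k y x _ <-].
Qed.

Fact single_subproof i (x : V i) :
  (eqtype.dfwith (fun j => 0 : V j) x : pi_mod V) \in @fin_supp R I V.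
Proof.
rewrite inE; apply: (sub_finite_set _ (finite_set1 i)) => j /=.
by case: eqtype.dfwithP => // ij; rewrite eq_sym in ij.
Qed.

Definition dsum_single i (x : V i) : dsum V :=
  Submod (fin_supp_closed V) (single_subproof x).

Lemma dsum_single_in i (x : V i) : submod_val (dsum_single x) i = x.
Proof. exact: eqtype.dfwith_in. Qed.

Lemma dsum_single_out i j (x : V i) : i != j -> submod_val (dsum_single x) j = 0.
Proof. exact: eqtype.dfwith_out. Qed.

Section Basis.
Context (n : I -> nat) (b : forall i, 'I_(n i) -> V i) (N : nat).
Context (phi : 'I_N -> {i : I & 'I_(n i)}) (psi : {i : I & 'I_(n i)} -> 'I_N).
Hypothesis idx : dsum_index phi psi.

Definition dsum_frame (k : 'I_N) : dsum V := dsum_single (b (tagged (phi k))).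

Lemma dsum_frame_sum (a : 'I_N -> R) i :
  submod_val (\sum_k a k *: dsum_frame k) i =
  \sum_j a (psi (Tagged (fun i => 'I_(n i)) j)) *: b j.
Proof.
have [phiK psiK] := idx; rewrite dsum_val_sum.
pose h (j : 'I_(n i)) := psi (Tagged (fun i => 'I_(n i)) j).
have h_inj : injective h.
  move=> j j' /(congr1 phi); rewrite !psiK => /eqP.
  by rewrite -tag_eqE /tag_eq /= eqxx /= tagged_asE => /eqP.
rewrite -(big_rmcond (fun k => k \in h @: 'I_(n i))) => [|k nk].
  rewrite big_imset/=; last by move=> ? ? _ _; exact: h_inj.
  apply: eq_bigr => j _; congr (_ *: _).
  by rewrite /dsum_frame /h psiK; exact: dsum_single_in.
rewrite /dsum_frame dsum_single_out ?scaler0//.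
apply: contraNneq nk => ki; apply/imsetP.
case: (phi k) ki (phiK k) => i' j /= ii' <-; subst i'.
by exists j.
Qed.

Lemma dsum_frame_basis : (forall i, is_basis (b (i := i))) -> is_basis dsum_frame.
Proof.
move=> bb v; have [phiK psiK] := idx.
exists (fun k => coords (b (i := _)) (submod_val v (tag (phi k))) 0 (tagged (phi k))).
split.
  apply: eq_dsum => i; rewrite dsum_frame_sum [LHS](coordsE _ (bb i)).
  by apply: eq_bigr => j _; rewrite psiK.
move=> a va; apply/funext => k.
set i := tag (phi k).
have : submod_val v i = \sum_j a (psi (Tagged (fun i => 'I_(n i)) j)) *: b j.
  by rewrite va dsum_frame_sum.
rewrite [LHS](coordsE _ (bb i)) => /(basis_inj (bb i)) ->.
by congr (a _); rewrite -[RHS]phiK; congr psi; rewrite /i; case: (phi k).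
Qed.

End Basis.
End DsumBasis.

(** * Even and odd parts of a complex *)

Section ShiftedSum.
Context (R : comNzRingType) (I J : Type) (V : I -> lmodType R) (W : J -> lmodType R).
Context (f : J -> I) (g : I -> J) (fK : cancel f g).
Context (u : forall j, {linear V (f j) -> W j}).

Fact dsum_shift_subproof (v : dsum V) :
  ((fun j => u j (submod_val v (f j))) : pi_mod W) \in @fin_supp _ _ W.
Proof.
have := submod_valP v; rewrite !inE => Fv.
apply: sub_finite_set (finite_image g Fv) => j /= fv.
by exists (f j) => // v0; apply: fv; rewrite v0 linear0.
Qed.

(** This serves the components of a differential or a homotopy between even and odd parts that move
    the summation index by one; [g] carries the finite support along. *)
Definition dsum_shift_fun (v : dsum V) : dsum W :=
  Submod (fin_supp_closed W) (dsum_shift_subproof v).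

Fact dsum_shift_linear : linear dsum_shift_fun.
Proof.
move=> a x y; apply: val_inj; apply: functional_extensionality_dep => j.
exact: linearP.
Qed.

Definition dsum_shift : {linear dsum V -> dsum W} := lin_pack dsum_shift_linear.

End ShiftedSum.

Section Parity.
Context (F : numFieldType).
Implicit Types C D : cochain F.

(** Degrees such as [2 * (k - 1) + 1 + 1] and [2 * k] are equal without being convertible; vectors
    are carried along the equality. *)
Definition cochain_cast C i j (E : i = j) : {linear C i -> C j} :=
  eq_rect i (fun j => {linear C i -> C j}) idfun j E.

Lemma odd_succ (k : int) : 2 * (k - 1) + 1 + 1 = 2 * k.
Proof. lia. Qed.

Section TotalMaps.
Context C (h : forall i, {linear C (i + 1) -> C i}).

Let d_eo : {linear ev C -> od C} := dsum_map (fun k => cdiff C (2 * k)).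
Let h_oe : {linear od C -> ev C} := dsum_map (fun k => h (2 * k)).
Let d_oe : {linear od C -> ev C} :=
  dsum_shift (f := fun k => k - 1) (subrK 1)
    (fun k => cochain_cast C (odd_succ k) \o cdiff C (2 * (k - 1) + 1)).
Fact even_succ (k : int) : 2 * (k + 1) = 2 * k + 1 + 1.
Proof. lia. Qed.
Let h_eo : {linear ev C -> od C} :=
  dsum_shift (f := fun k => k + 1) (addrK 1)
    (fun k => h (2 * k + 1) \o cochain_cast C (even_succ k)).

Let d_oe_eo v : d_oe (d_eo v) = 0.
Proof.
apply: eq_dsum => k; rewrite [LHS]/=.
by rewrite cdiff2 linear0.
Qed.

Let d_eo_oe v : d_eo (d_oe v) = 0.
Proof.
apply: eq_dsum => k; rewrite [LHS]/= [RHS]/(0 : C (2 * k + 1)).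
(* Once [2 * k] is a variable, the equality of degrees can be eliminated. *)
move: (odd_succ k) (submod_val v _); move: (2 * k) => m E x.
by subst m; rewrite /= cdiff2.
Qed.

Context (f : chain_map C C).
Hypothesis fh : forall i v,
  f (i + 1) v - v = cdiff C i (h i v) + h (i + 1) (cdiff C (i + 1) v).

Let ev_mapE v : ev_map f v = v + h_oe (d_eo v) + d_oe (h_eo v).
Proof.
apply: eq_dsum => k; rewrite -addrA.
rewrite [RHS]/(submod_val v k + (h (2 * k) (cdiff C (2 * k) (submod_val v k)) +
  cochain_cast C (odd_succ k) (cdiff C _ (h _
    (cochain_cast C (even_succ _) (submod_val v (k - 1 + 1))))))).
(* Lowering the index and raising it again returns to [k]; the transports agree because equality
   proofs between integers are unique. *)
have -> : cochain_cast C (even_succ (k - 1)) (submod_val v (k - 1 + 1)) =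
    cochain_cast C (esym (odd_succ k)) (submod_val v k).
  move: (even_succ _) (esym _); move: (_ + 1 + 1) => m.
  rewrite subrK => E E'; by rewrite (eq_irrelevance E E').
rewrite [LHS]/(f (2 * k) (submod_val v k)); move: (submod_val v k) => x.
rewrite -[LHS](subrK x) [LHS]addrC; congr (x + _).
move: (odd_succ k); move: (2 * k) x => m x E; subst m.
by rewrite /= fh [LHS]addrC.
Qed.

Let od_mapE w : od_map f w = w + d_eo (h_oe w) + h_eo (d_oe w).
Proof.
apply: eq_dsum => k; rewrite -addrA.
rewrite [RHS]/(submod_val w k + (cdiff C (2 * k) (h (2 * k) (submod_val w k)) +
  h (2 * k + 1) (cochain_cast C (even_succ k) (cochain_cast C (odd_succ (k + 1))
    (cdiff C _ (submod_val w (k + 1 - 1))))))).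
have -> : cochain_cast C (even_succ k) (cochain_cast C (odd_succ (k + 1))
    (cdiff C _ (submod_val w (k + 1 - 1)))) = cdiff C _ (submod_val w k).
  move: (even_succ _) (odd_succ _); rewrite addrK; move: (2 * (k + 1)) => m E E'.
  by subst m; rewrite (eq_irrelevance E' erefl).
rewrite [LHS]/(f (2 * k + 1) (submod_val w k)).
by have/eqP := fh (submod_val w k); rewrite subr_eq => /eqP H; exact: (etrans H (addrC _ _)).
Qed.

(* As [d d = 0], [1 + hd + dh] is [(1 + hd)(1 + dh)] on either part, and
   [det (1 + hd)] on one part is [det (1 + dh)] on the other. *)
Lemma ldet_ev_od m n (e : 'I_m -> ev C) (e' : 'I_n -> od C) :
  is_basis e -> is_basis e' -> ldet e (ev_map f) = ldet e' (od_map f).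
Proof.
move=> be be'.
pose P : {linear ev C -> ev C} := idfun \+ (h_oe \o d_eo).
pose Q : {linear ev C -> ev C} := idfun \+ (d_oe \o h_eo).
pose P' : {linear od C -> od C} := idfun \+ (d_eo \o h_oe).
pose Q' : {linear od C -> od C} := idfun \+ (h_eo \o d_oe).
have -> : ldet e (ev_map f) = ldet e (P \o Q).
  apply: eq_ldet => v; rewrite ev_mapE.
  rewrite -[RHS]/(v + d_oe (h_eo v) + h_oe (d_eo (v + d_oe (h_eo v)))).
  by rewrite [d_eo (_ + _)]linearD d_eo_oe addr0 addrAC.
have -> : ldet e' (od_map f) = ldet e' (Q' \o P').
  apply: eq_ldet => w; rewrite od_mapE.
  rewrite -[RHS]/(w + d_eo (h_oe w) + h_eo (d_oe (w + d_eo (h_oe w)))).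
  by rewrite [d_oe (_ + _)]linearD d_oe_eo addr0.
rewrite !ldet_comp// mulrC.
by congr (_ * _); apply: ldet_add1_mulC.
Qed.

End TotalMaps.
End Parity.

(** * Homotopy equivalences *)

(** Formulas with [dh + hd] are typed in degrees [i + 1] only. Every integer has this form, and the
    transport along [i - 1 + 1 = i] is harmless because equality proofs between integers are
    unique. *)
Lemma int_shift_family (T : int -> Type) (f : forall i, T (i + 1)) :
  {g : forall i, T i | forall i, g (i + 1) = f i}.
Proof.
exists (fun i => eq_rect (i - 1 + 1) T (f (i - 1)) i (subrK 1 i)) => i.
move: (subrK 1 (i + 1)).
suff : forall j (e : j + 1 = i + 1), eq_rect (j + 1) T (f j) (i + 1) e = f i by [].
by move=> j e; have ji := addIr 1 e; subst j; rewrite (eq_irrelevance e erefl).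
Qed.

Lemma int_shift_ind (P : int -> Prop) : (forall i, P (i + 1)) -> forall i, P i.
Proof. by move=> h i; rewrite -(subrK 1 i). Qed.

Section Contraction.
Context (F : numFieldType).
Implicit Types C D : cochain F.

(** The homotopy of a deformation retraction onto cohomology, with its side conditions: [dp] and
    [pd] become idempotents whose products with each other vanish. *)
Definition contraction C (p : forall i, {linear C (i + 1) -> C i}) :=
  [/\ forall i v, cdiff C i (p i (cdiff C i v)) = cdiff C i v,
      forall i v, p i (cdiff C i (p i v)) = p i v &
      forall i v, p i (p (i + 1) v) = 0].

(** Generalized inverses [p0] of the differentials satisfy the first law. Passing to [p1 = p0 d p0]
    adds the second, and [p = p1 (1 - p1 d)] adds [pp = 0] while keeping both. *)
Lemma contraction_exists C (n : int -> nat) (b : forall i, 'I_(n i) -> C i) :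
  (forall i, is_basis (b i)) -> exists p, @contraction C p.
Proof.
move=> bb; have g i := generalized_inverse (cdiff C i) (bb i) (bb (i + 1)).
pose p0 i := projT1 (cid (g i)).
have dpd i v : cdiff C i (p0 i (cdiff C i v)) = cdiff C i v.
  by rewrite /p0; case: cid.
pose p1 i : {linear C (i + 1) -> C i} := p0 i \o cdiff C i \o p0 i.
have dp1d i v : cdiff C i (p1 i (cdiff C i v)) = cdiff C i v.
  by rewrite /p1 /= !dpd.
have p1dp1 i v : p1 i (cdiff C i (p1 i v)) = p1 i v by rewrite /p1 /= !dpd.
pose p i : {linear C (i + 1) -> C i} :=
  p1 i \o (idfun \- (p1 (i + 1) \o cdiff C (i + 1))).
have pE i v : p i v = p1 i (v - p1 (i + 1) (cdiff C (i + 1) v)) by [].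
have pd i v : p i (cdiff C i v) = p1 i (cdiff C i v).
  by rewrite pE cdiff2 linear0 subr0.
exists p; split=> i v.
- by rewrite pd dp1d.
- by rewrite pd pE p1dp1.
- by rewrite !pE p1dp1 subrr linear0.
Qed.

(** A relation and not a formula, since [1 - dp - pd] is typed only in degrees [i + 1]. *)
Definition harmonic C (p : forall i, {linear C (i + 1) -> C i})
    (q : forall i, {linear C i -> C i}) :=
  forall i v, q (i + 1) v = v - cdiff C i (p i v) - p (i + 1) (cdiff C (i + 1) v).

Lemma harmonic_exists C (p : forall i, {linear C (i + 1) -> C i}) :
  exists q, harmonic p q.
Proof.
pose q0 i : {linear C (i + 1) -> C (i + 1)} :=
  idfun \- (cdiff C i \o p i) \- (p (i + 1) \o cdiff C (i + 1)).
have [q qE] := @int_shift_family (fun i => {linear C i -> C i}) q0.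
by exists q => i v; rewrite qE.
Qed.

Section Harmonic.
Context C (p : forall i, {linear C (i + 1) -> C i}) (q : forall i, {linear C i -> C i}).
Hypotheses (cp : contraction p) (qE : harmonic p q).

Lemma harmonicd i v : q (i + 1) (cdiff C i v) = 0.
Proof. by have [dpd pdp pp] := cp; rewrite qE dpd cdiff2 linear0 subr0 subrr. Qed.

Lemma dharmonic i v : cdiff C i (q i v) = 0.
Proof.
have [dpd pdp pp] := cp; elim/int_shift_ind: i v => i v.
by rewrite qE !linearB/= cdiff2 dpd subr0 subrr.
Qed.

Lemma harmonicp i v : q i (p i v) = 0.
Proof.
have [dpd pdp pp] := cp; elim/int_shift_ind: i v => i v.
by rewrite qE pp linear0 subr0 pdp subrr.
Qed.

Lemma pharmonic i v : p i (q (i + 1) v) = 0.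
Proof.
have [dpd pdp pp] := cp.
by rewrite qE !linearB/= pdp pp subr0 subrr.
Qed.

Lemma harmonicK i v : q i (q i v) = q i v.
Proof.
have [dpd pdp pp] := cp; elim/int_shift_ind: i v => i v.
by rewrite {1}qE dharmonic pharmonic !linear0 !addr0.
Qed.

Lemma contraction_split i v :
  v = q (i + 1) v + cdiff C i (p i v) + p (i + 1) (cdiff C (i + 1) v).
Proof. by rewrite qE addrAC !subrK. Qed.

(** As [dp] in degree [i + 1] has the trace of [pd] in degree [i], the trace of [pd] in each degree
    is determined by the rank, the harmonic trace and the trace of [pd] one degree lower. *)
Lemma contraction_trace (n : int -> nat) (b : forall i, 'I_(n i) -> C i) i :
  (forall i, is_basis (b i)) ->
  (n (i + 1))%:R = ltrace (b (i + 1)) (q (i + 1)) +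
    ltrace (b i) (p i \o cdiff C i) +
    ltrace (b (i + 1)) (p (i + 1) \o cdiff C (i + 1)).
Proof.
move=> bb; rewrite -(ltrace_id (bb (i + 1))).
rewrite (ltraceC (cdiff C i) (p i) (bb i) (bb (i + 1))) -!ltraceD//.
by apply: eq_ltrace => v /=; rewrite -contraction_split.
Qed.

End Harmonic.

Definition homotopic_id C (f : chain_map C C) :=
  exists h : forall i, {linear C (i + 1) -> C i}, forall i v,
    f (i + 1) v - v = cdiff C i (h i v) + h (i + 1) (cdiff C (i + 1) v).

(** Since [f q v] is a cycle, [s] changes it only by a boundary, which [f'] maps to a boundary and
    [q] then kills. Likewise [f' f] changes the cycle [q v] only by a boundary. *)
Lemma harmonic_roundtrip C D p q r s (f : chain_map C D) (f' : chain_map D C) i v :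
  @contraction C p -> harmonic p q -> @contraction D r -> harmonic r s ->
  homotopic_id (cm_comp f' f) -> q i (f' i (s i (f i (q i v)))) = q i v.
Proof.
move=> cp qE cr sE [h fh]; elim/int_shift_ind: i v => i v.
rewrite sE -(cm_comm f) (dharmonic cp qE) !linear0 addr0 !linearB/=.
rewrite (cm_comm f') (harmonicd cp qE) subr0.
rewrite -[f' _ _](subrK (q (i + 1) v)) fh (dharmonic cp qE) linear0 addr0.
by rewrite linearD/= (harmonicd cp qE) add0r (harmonicK cp qE).
Qed.

Section Glue.
Context C D (f : chain_map C D) (f' : chain_map D C).
Context (p : forall i, {linear C (i + 1) -> C i}) (q : forall i, {linear C i -> C i}).
Context (r : forall i, {linear D (i + 1) -> D i}) (s : forall i, {linear D i -> D i}).
Context (k : forall i, {linear C i -> D i}) (k' : forall i, {linear D i -> C i}).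
Hypotheses (cp : @contraction C p) (qE : harmonic p q).
Hypotheses (cr : @contraction D r) (sE : harmonic r s).
Hypothesis roundtrip : forall i v, q i (f' i (s i (f i (q i v)))) = q i v.
Hypothesis kk : forall i v, k' i (k i v) = p i (cdiff C i v).
Hypothesis kk' : forall i v, k i (k' i v) = r i (cdiff D i v).
Hypothesis kpd : forall i v, k i (p i (cdiff C i v)) = k i v.
Hypothesis krd : forall i v, k' i (r i (cdiff D i v)) = k' i v.

(** The three summands of [w] act on the harmonic part, on the image of [pd] and on the boundaries.
    The last one, [d k p], is what commutation with the differential forces once [k] is given. The
    inverse has the same shape with the roles exchanged. *)
Lemma glueK i v (w := s (i + 1) (f (i + 1) (q (i + 1) v)) + k (i + 1) v +
    cdiff D i (k i (p i v))) :
  q (i + 1) (f' (i + 1) (s (i + 1) w)) + k' (i + 1) w +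
    cdiff C i (k' i (r i w)) = v.
Proof.
have [dpd pdp pp] := cp; have [drd rdr rr] := cr.
have rdk j u : k j u = r j (cdiff D j (k j u)) by rewrite -kk' kk kpd.
have -> : q (i + 1) (f' (i + 1) (s (i + 1) w)) = q (i + 1) v.
  rewrite /w !linearD/= (harmonicK cr sE) (harmonicd cr sE) !linear0 addr0.
  by rewrite rdk (harmonicp cr sE) !linear0 addr0 roundtrip.
have -> : k' (i + 1) w = p (i + 1) (cdiff C (i + 1) v).
  rewrite -krd /w !linearD/= (dharmonic cr sE) cdiff2 !linear0 add0r addr0.
  by rewrite krd kk.
have -> : k' i (r i w) = p i v.
  rewrite /w !linearD/= (pharmonic cr sE) linear0 add0r.
  by rewrite rdk rr linear0 add0r krd kk pdp.
by rewrite addrAC -contraction_split.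
Qed.

End Glue.

Lemma ltrace_dim0 (V : lmodType F) n (e : 'I_n -> V) phi :
  n = 0%N -> ltrace e phi = 0.
Proof. by move=> n0; apply: big1 => -[k kn] _; exfalso; rewrite n0 in kn. Qed.

Lemma mutually_inverse_comm C D (g : forall i, {linear C i -> D i})
    (g' : forall i, {linear D i -> C i}) :
  (forall i v, g (i + 1) (cdiff C i v) = cdiff D i (g i v)) ->
  (forall i, cancel (g i) (g' i)) -> (forall i, cancel (g' i) (g i)) ->
  forall i v, g' (i + 1) (cdiff D i v) = cdiff C i (g' i v).
Proof. by move=> gd gK gK' i v; apply: (can_inj (gK (i + 1))); rewrite gK' gd gK'. Qed.

(* The inverse equivalence [f'] restricts to an isomorphism on the harmonic
   parts; the acyclic parts have equal dimensions in each degree, as follows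
   inductively from the lowest one, and are matched by [k]. *)
Lemma homotopy_equivalence_iso C D (n : int -> nat)
    (b : forall i, 'I_(n i) -> C i) (c : forall i, 'I_(n i) -> D i) (N : nat)
    (f : chain_map C D) (f' : chain_map D C) :
  (forall i, is_basis (b i)) -> (forall i, is_basis (c i)) ->
  (forall i : int, N%:Z < `|i| -> n i = 0%N) ->
  homotopic_id (cm_comp f' f) -> homotopic_id (cm_comp f f') ->
  exists g g', mutually_inverse g g' /\ homotopic f g.
Proof.
move=> bb bc n0 f'f ff'.
have [p cp] := contraction_exists bb.
have [r cr] := contraction_exists bc.
have [q qE] := harmonic_exists p.
have [s sE] := harmonic_exists r.
have [dpd pdp pp] := cp; have [drd rdr rr] := cr.
have rt i v := @harmonic_roundtrip C D p q r s f f' i v cp qE cr sE f'f.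
have rt' i v := @harmonic_roundtrip D C r s p q f' f i v cr sE cp qE ff'.
have trqs i : ltrace (b i) (q i) = ltrace (c i) (s i).
  pose u : {linear C i -> D i} := s i \o f i \o q i.
  pose u' : {linear D i -> C i} := q i \o f' i \o s i.
  transitivity (ltrace (b i) (u' \o u)).
    by apply: eq_ltrace => v; rewrite /= (harmonicK cr sE) rt.
  rewrite (ltraceC u u' (bb i) (bc i)).
  by apply: eq_ltrace => v; rewrite /= (harmonicK cp qE) rt'.
have trpr i : ltrace (b i) (p i \o cdiff C i) = ltrace (c i) (r i \o cdiff D i).
  have [/n0 i0|iN] := ltP N%:Z `|i|; first by rewrite !ltrace_dim0.
  (* Degree [- (N + 1)] lies just below the bounded range, so both ranks vanish there; the induction
     climbs from it. *)
  have {iN} [m ->] : exists m : nat, i = - N.+1%:Z + m%:Z.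
    exists `|(i + N.+1%:Z)%R|%N; move: iN; rewrite ler_norml => /andP[iN _].
    by rewrite gez0_abs; lia.
  elim: m => [|m IH].
    have e0 : n (- N.+1%:Z + 0%:Z) = 0%N by apply: n0; rewrite addr0 normrN; lia.
    by rewrite !ltrace_dim0.
  have -> : - N.+1%:Z + m.+1%:Z = - N.+1%:Z + m%:Z + 1 by lia.
  move: (- _ + _) IH => {}i IH.
  have := contraction_trace qE i bb; rewrite (contraction_trace sE i bc).
  by rewrite -trqs -IH => /addrI.
have K i := idempotent_equiv (a := p i \o cdiff C i) (b := r i \o cdiff D i)
  (bb i) (bc i) (fun v => pdp i _) (fun v => rdr i _) (trpr i).
pose k i := projT1 (cid (K i)).
have K' i : exists k' : {linear D i -> C i},
    [/\ forall v, k' (k i v) = p i (cdiff C i v),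
        forall w, k i (k' w) = r i (cdiff D i w),
        forall v, k i (p i (cdiff C i v)) = k i v &
        forall w, k' (r i (cdiff D i w)) = k' w] := projT2 (cid (K i)).
pose k' i := projT1 (cid (K' i)).
have k'k i v : k' i (k i v) = p i (cdiff C i v) by rewrite /k'; case: cid => ? [].
have kk' i v : k i (k' i v) = r i (cdiff D i v) by rewrite /k'; case: cid => ? [].
have kpd i v : k i (p i (cdiff C i v)) = k i v by have [? []] := K' i.
have krd i v : k' i (r i (cdiff D i v)) = k' i v by rewrite /k'; case: cid => ? [].
have rdk j u : k j u = r j (cdiff D j (k j u)) by rewrite -kk' k'k kpd.
have [g gE] := @int_shift_family (fun i => {linear C i -> D i})
  (fun i => (s (i + 1) \o f (i + 1) \o q (i + 1)) \+ k (i + 1) \+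
            (cdiff D i \o k i \o p i)).
have [g' gE'] := @int_shift_family (fun i => {linear D i -> C i})
  (fun i => (q (i + 1) \o f' (i + 1) \o s (i + 1)) \+ k' (i + 1) \+
            (cdiff C i \o k' i \o r i)).
have gK i : cancel (g i) (g' i).
  elim/int_shift_ind: i => i v; rewrite gE gE'.
  exact: (glueK cp qE cr sE rt k'k kk' kpd krd).
have gK' i : cancel (g' i) (g i).
  elim/int_shift_ind: i => i v; rewrite gE gE'.
  exact: (glueK cr sE cp qE rt' kk' k'k krd kpd).
have gd i v : g (i + 1) (cdiff C i v) = cdiff D i (g i v).
  elim/int_shift_ind: i v => i v; rewrite !gE /= !linearD/=.
  rewrite (harmonicd cp qE) (dharmonic cr sE) !cdiff2 kpd !linear0 addr0.
  by rewrite !add0r -(kpd _ (cdiff C _ v)) cdiff2 !linear0 add0r.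
exists (ChainMap gd), (ChainMap (mutually_inverse_comm gd gK gK')); split=> //.
(* Three homotopies are added: [r f] deforms [f] to [s f], then [s f p] deforms this to [s f q], and
   [k p] deforms the acyclic summands [k + d k p] of [g] to zero. *)
exists (fun i => (r i \o f (i + 1)) \+ (s i \o f i \o p i) \- (k i \o p i)) => i v /=.
have sfE : s (i + 1) (f (i + 1) v) = s (i + 1) (f (i + 1) (q (i + 1) v)) +
    s (i + 1) (f (i + 1) (p (i + 1) (cdiff C (i + 1) v))).
  rewrite {1}(contraction_split qE v) !linearD/= cm_comm (harmonicd cr sE).
  by rewrite addr0.
rewrite gE /= !linearB !linearD/= (dharmonic cr sE) kpd addr0 cm_comm.
rewrite {1}(contraction_split sE (f (i + 1) v)) sfE.
rewrite !addrA (ACl (1*5*3*7*4*2*6)) /= subrr add0r.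
by rewrite -!addrA.
Qed.

End Contraction.

(** * Berezinians of chain maps *)

Section Homotopy.
Context (R : comNzRingType).
Implicit Types C D E : cochain R.

Lemma homotopic_sym C D (f g : chain_map C D) : homotopic f g -> homotopic g f.
Proof.
move=> [h fg]; exists (fun i => \- h i) => i v /=.
by rewrite -[LHS]opprB fg opprD linearN.
Qed.

Lemma homotopic_trans C D (f g k : chain_map C D) :
  homotopic f g -> homotopic g k -> homotopic f k.
Proof.
move=> [h fg] [h' gk]; exists (fun i => h i \+ h' i) => i v /=.
by rewrite linearD/= addrACA -fg -gk addrA subrK.
Qed.

Lemma homotopic_comp C D E (f f' : chain_map D E) (g g' : chain_map C D) :
  homotopic f f' -> homotopic g g' -> homotopic (cm_comp f g) (cm_comp f' g').
Proof.
move=> [h fh] [k gk]; exists (fun i => (f i \o k i) \+ (h i \o g' (i + 1))) => i v /=.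
rewrite linearD/= -(cm_comm f) (cm_comm g') addrACA -linearD -gk -fh linearB/=.
by rewrite addrA subrK.
Qed.

Lemma mutually_inverse_comp C D E (f : chain_map D E) f' (g : chain_map C D) g' :
  mutually_inverse f f' -> mutually_inverse g g' ->
  mutually_inverse (cm_comp f g) (cm_comp g' f').
Proof.
move=> ff' gg' i; have [fK f'K] := ff' i; have [gK g'K] := gg' i.
by split; apply: can_comp.
Qed.

Lemma mutually_inverse_sym C D (f : chain_map C D) f' :
  mutually_inverse f f' -> mutually_inverse f' f.
Proof. by move=> ff' i; have [] := ff' i. Qed.

Lemma ev_mapK C D (f : chain_map C D) f' : mutually_inverse f f' ->
  cancel (ev_map f) (ev_map f').
Proof.
by move=> ff' v; apply: eq_dsum => i; have [fK _] := ff' (2 * i); exact: fK.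
Qed.

Lemma od_mapK C D (f : chain_map C D) f' : mutually_inverse f f' ->
  cancel (od_map f) (od_map f').
Proof.
by move=> ff' v; apply: eq_dsum => i; have [fK _] := ff' (2 * i + 1); exact: fK.
Qed.

Lemma submod_inj (W : lmodType R) (P : {pred W}) (cP : submod_closed P)
    (u v : submod cP) : submod_val u = submod_val v -> u = v.
Proof. exact: val_inj. Qed.

Lemma submod_val_lin (W : lmodType R) (P : {pred W}) (cP : submod_closed P)
    (a : R) (u v : submod cP) :
  submod_val (a *: u + v) = a *: submod_val u + submod_val v.
Proof. by []. Qed.

Lemma submod_valZ (W : lmodType R) (P : {pred W}) (cP : submod_closed P)
    (a : R) (u : submod cP) : submod_val (a *: u) = a *: submod_val u.
Proof. by []. Qed.

Lemma tensor_mapE (A B A' B' : lmodType R) (f : {linear A -> A'})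
    (g : {linear B -> B'}) t xi eta :
  submod_val (tensor_map f g t) xi eta =
  submod_val t (dual_map f xi) (dual_map g eta).
Proof. by []. Qed.

Lemma tensor_map_linear (A B A' B' : lmodType R) (f : {linear A -> A'})
  (g : {linear B -> B'}) : linear (tensor_map f g).
Proof.
move=> a u v; apply: submod_inj; apply/funext => xi; apply/funext => eta.
by rewrite tensor_mapE !submod_val_lin.
Qed.

Lemma ber_map_linear p q C D (f : chain_map C D) f' : linear (@ber_map R p q C D f f').
Proof. exact: tensor_map_linear. Qed.

Lemma ext_mapK n (V W : lmodType R) (f : {linear V -> W}) (g : {linear W -> V}) :
  cancel f g -> cancel (@ext_map R n V W f) (@ext_map R n W V g).
Proof.
move=> fK w; apply: val_inj; apply/funext => xi /=; congr (submod_val w _).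
by apply/funext => i; apply: val_inj; apply/funext => v /=; rewrite fK.
Qed.

Lemma dual_mapK (V W : lmodType R) (f : {linear V -> W}) (g : {linear W -> V}) :
  cancel f g -> cancel (dual_map g) (dual_map f).
Proof. by move=> fK xi; apply: val_inj; apply/funext => v /=; rewrite fK. Qed.

Lemma tensor_mapK (A B A' B' : lmodType R) (f : {linear A -> A'}) (g : {linear B -> B'})
    (f' : {linear A' -> A}) (g' : {linear B' -> B}) :
  cancel f f' -> cancel g g' -> cancel (tensor_map f g) (tensor_map f' g').
Proof.
move=> fK gK t; apply: val_inj; apply/funext => xi; apply/funext => eta /=.
by congr (submod_val t _ _); apply: dual_mapK.
Qed.

Lemma ber_mapK p q C D (f : chain_map C D) f' : mutually_inverse f f' ->
  cancel (@ber_map R p q C D f f') (@ber_map R p q D C f' f).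
Proof.
move=> ff'; apply: tensor_mapK; apply: ext_mapK; first exact: ev_mapK.
by apply: dual_mapK; apply: od_mapK.
Qed.

(** The composite enters through a pointwise equation because [ev_map] and [od_map] of a composite
    equal the composites only by extensionality. *)
Lemma dual_map_comp (V W X : lmodType R) (f : {linear W -> X})
    (g : {linear V -> W}) (h : {linear V -> X}) xi :
  (forall v, h v = f (g v)) -> dual_map h xi = dual_map g (dual_map f xi).
Proof. by move=> hE; apply: val_inj; apply/funext => v /=; rewrite hE. Qed.

Lemma ext_map_comp n (V W X : lmodType R) (f : {linear W -> X})
    (g : {linear V -> W}) (h : {linear V -> X}) (w : ext_pow n V) :
  (forall v, h v = f (g v)) -> ext_map h w = ext_map f (ext_map g w).
Proof.
move=> hE; apply: val_inj; apply/funext => xi /=; congr (submod_val w _).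
by apply/funext => i; apply: dual_map_comp.
Qed.

Lemma tensor_map_comp (A B A1 B1 A2 B2 : lmodType R)
    (f : {linear A1 -> A2}) (f1 : {linear A -> A1}) (f2 : {linear A -> A2})
    (g : {linear B1 -> B2}) (g1 : {linear B -> B1}) (g2 : {linear B -> B2}) t :
  (forall x, f2 x = f (f1 x)) -> (forall x, g2 x = g (g1 x)) ->
  tensor_map f2 g2 t = tensor_map f g (tensor_map f1 g1 t).
Proof.
move=> fE gE; apply: val_inj; apply/funext => xi; apply/funext => eta /=.
by congr (submod_val t _ _); apply: dual_map_comp.
Qed.

Lemma ber_map_comp p q C D E (f : chain_map D E) f' (g : chain_map C D) g' w :
  @ber_map R p q C E (cm_comp f g) (cm_comp g' f') w =
  @ber_map R p q D E f f' (@ber_map R p q C D g g' w).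
Proof.
apply: tensor_map_comp => x; apply: ext_map_comp => v; first exact: eq_dsum.
by apply: dual_map_comp => u; apply: eq_dsum.
Qed.

End Homotopy.

Lemma homotopic_comp_id (F : numFieldType) (C D : cochain F)
    (f g : chain_map C D) f' :
  homotopic f g -> mutually_inverse f f' -> homotopic_id (cm_comp f' g).
Proof.
move=> fg ff'; have [h gh] := homotopic_sym fg; exists (fun i => f' i \o h i) => i v /=.
have [fK _] := ff' (i + 1).
by rewrite -[X in _ - X = _]fK -linearB gh linearD/= cm_comm.
Qed.

(** * Berezinians in bases *)

Section Line.
Context (R : comNzRingType).

Lemma is_basis1 (V : lmodType R) (e : 'I_1 -> V) (al : V -> R) :
  (forall (a : R) u, al (a *: u) = a * al u) -> al (e ord0) = 1 ->
  (forall u, u = al u *: e ord0) -> is_basis e.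
Proof.
move=> alZ al1 ale v; exists (fun => al v); split; first by rewrite big_ord1 -ale.
move=> a; rewrite big_ord1 => ->; apply/funext => i.
by rewrite alZ al1 mulr1 (ord1 i).
Qed.

Lemma ext_pow_functional n (V : lmodType R) (e' : 'I_n -> dualmod V) :
  {al : dualmod (ext_pow n V) | forall w, submod_val al w = submod_val w e'}.
Proof.
have L : (fun w : ext_pow n V => submod_val w e') \in @lin_form R (ext_pow n V).
  by rewrite inE.
by exists (Submod (lin_form_closed (ext_pow n V)) L).
Qed.

Section BerFrame.
Context (C : cochain R) (p q : nat) (e : 'I_p -> ev C) (f : 'I_q -> od C).
Context (f' : 'I_q -> dualmod (od C)).
Hypotheses (be : is_basis e) (bf : is_basis f) (ff' : dual_family f f').

(** The coordinate is evaluation at dual families [e'] and [f'']; the latter consists of elements of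
    the bidual, since the odd part enters through its dual. *)
Lemma ber_frame_basis :
  is_basis (fun _ : 'I_1 => tensor_pure (ext_wedge e) (ext_wedge f')).
Proof.
have [e' ee'] := dual_family_exists be.
have bf' := dual_basis bf ff'.
have [f'' ff''] := dual_family_exists bf'.
have [al alE] := ext_pow_functional e'.
have [bt btE] := ext_pow_functional f''.
apply: (is_basis1 (al := fun t :
  tensor (ext_pow p (ev C)) (ext_pow q (dualmod (od C))) => submod_val t al bt : R)).
- by move=> a t; rewrite submod_valZ.
- rewrite -[LHS]/((submod_val al (ext_wedge e) : R) * (submod_val bt (ext_wedge f') : R)).
  by rewrite alE btE !wedge_dual// mulr1.
by move=> t; apply: tensor_pure_expand => w; rewrite (alE, btE) -?ext_pow_wedge.
Qed.

End BerFrame.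
End Line.

Section BerMap.
Context (F : fieldType) (C D : cochain F) (p q : nat).
Context (e : 'I_p -> ev C) (f : 'I_q -> od C) (f' : 'I_q -> dualmod (od C)).
Context (e1 : 'I_p -> ev D) (f1 : 'I_q -> od D) (f1' : 'I_q -> dualmod (od D)).
Hypotheses (be : is_basis e) (bf : is_basis f) (ff' : dual_family f f').
Hypotheses (be1 : is_basis e1) (bf1 : is_basis f1) (ff1' : dual_family f1 f1').
Context (phi : chain_map C D) (phi' : chain_map D C) (inv : mutually_inverse phi phi').

Lemma det_ev_map_neq0 : \det (mxof e e1 (ev_map phi)) != 0.
Proof.
have := mxof_cancel be be1 (ev_mapK inv) => /(congr1 determinant).
by rewrite det_mulmx det1; apply: contra_eq_neq => ->; rewrite mul0r eq_sym oner_eq0.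
Qed.

Lemma det_od_mapV : \det (mxof f1 f (od_map phi')) = (\det (mxof f f1 (od_map phi)))^-1.
Proof.
have := mxof_cancel bf bf1 (od_mapK inv) => /(congr1 determinant).
rewrite det_mulmx det1 => d1; apply/esym/mulr1_eq/d1.
Qed.

(** The odd factor transforms by the transpose of the inverse, which puts its determinant in the
    denominator. *)
Lemma ber_map_frames :
  ber_map phi phi' (tensor_pure (ext_wedge e) (ext_wedge f')) =
  (\det (mxof e e1 (ev_map phi)) / \det (mxof f f1 (od_map phi))) *:
    tensor_pure (ext_wedge e1) (ext_wedge f1').
Proof.
apply: (etrans (tensor_map_pure _ _ _ _)).
rewrite [X in tensor_pure X _]ext_map_wedge [X in tensor_pure _ X]ext_map_wedge.
rewrite -det_od_mapV -tensor_pureZ; congr tensor_pure.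
  by apply: wedge_lin_comb => j; apply: (mxofE e).
rewrite -det_tr; apply: wedge_lin_comb => j.
rewrite [LHS](dual_family_expand _ bf1 ff1'); apply: eq_bigr => k _.
rewrite [in RHS]mxE [in RHS]mxE; congr (_ *: _).
exact: (dual_family_coords _ _ bf ff').
Qed.

End BerMap.

(** The quotients for [phi] and [psi] differ by the even and odd determinants of the self-map
    [phi' psi]. This map is homotopic to the identity, so the two are equal; it is invertible, so
    they cancel. *)
Lemma ber_map_homotopic (F : numFieldType) (C D : cochain F) p q
    (e : 'I_p -> ev C) (f : 'I_q -> od C) (e1 : 'I_p -> ev D) (f1 : 'I_q -> od D)
    (phi psi : chain_map C D) phi' psi' :
  is_basis e -> is_basis f -> is_basis e1 -> is_basis f1 ->
  mutually_inverse phi phi' -> mutually_inverse psi psi' -> homotopic phi psi ->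
  @ber_map F p q C D phi phi' = ber_map psi psi'.
Proof.
move=> be bf be1 bf1 Hphi Hpsi hom.
have [f' ff'] := dual_family_exists bf.
have [f1' ff1'] := dual_family_exists bf1.
have dd : \det (mxof e e1 (ev_map phi)) / \det (mxof f f1 (od_map phi)) =
    \det (mxof e e1 (ev_map psi)) / \det (mxof f f1 (od_map psi)).
  have evE : mxof e e1 (ev_map psi) = mxof e e (ev_map (cm_comp phi' psi)) *m
      mxof e e1 (ev_map phi).
    rewrite -mxof_comp//; apply: eq_mxof => v /=.
    by apply: eq_dsum => i; have [_ K] := Hphi (2 * i); rewrite /= K.
  have odE : mxof f f1 (od_map psi) = mxof f f (od_map (cm_comp phi' psi)) *m
      mxof f f1 (od_map phi).
    rewrite -mxof_comp//; apply: eq_mxof => v /=.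
    by apply: eq_dsum => i; have [_ K] := Hphi (2 * i + 1); rewrite /= K.
  have [h hE] := homotopic_comp_id hom Hphi.
  have := ldet_ev_od hE be bf; rewrite /ldet => dE.
  rewrite evE odE !det_mulmx dE.
  have : \det (mxof f f (od_map (cm_comp phi' psi))) != 0.
    rewrite -dE; apply: (det_ev_map_neq0 be be
      (mutually_inverse_comp (mutually_inverse_sym Hphi) Hpsi)).
  move: (\det _) => x x0.
  by rewrite invfM mulrACA divff// mul1r.
apply/funext => w.
have := linear_basis_eq (f := lin_pack (ber_map_linear phi phi'))
  (g := lin_pack (ber_map_linear psi psi')) (ber_frame_basis be bf ff').
by apply=> _ /=; rewrite !(ber_map_frames e bf ff' be1 bf1 ff1')// dd.
Qed.

(** * Smoothness at a point *)

Section CkAt.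
Context (R : realType).
Implicit Types V W : normedModType R.

(** The version of [Ck] for germs: each condition is asked near [x], so the notion is insensitive to
    changes of [f] away from [x] and involves no domain. *)
Fixpoint Ck_at V W (k : nat) (x : V) (f : V -> W) : Prop :=
  match k with
  | 0 => \forall y \near x, {for y, continuous f}
  | k.+1 => (\forall y \near x, differentiable f y) /\
            forall v, Ck_at k x (fun y => 'D_v f y)
  end.

Lemma near_eq_differentiable V W (f g : V -> W) (x : V) :
  (\forall y \near x, f y = g y) -> differentiable f x -> differentiable g x.
Proof.
move=> fg /diff_locallyP[dfc dfE].
have gE : g \o shift x = cst (g x) + 'd f x +o_ 0 id.
  apply/eqaddoP => e e0; have /eqaddoP/(_ e e0) := dfE.
  have : \forall y \near 0, f (y + x) = g (y + x).
    by have := fg; rewrite (near_shift 0) subr0.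
  apply: filterS2 => y /= fgy.
  by rewrite !fctE /= fgy (nbhs_singleton fg).
by apply/diff_locallyP; rewrite (diff_unique dfc gE); split.
Qed.

Lemma near_eq_for_continuous (T : topologicalType) W (f g : T -> W) (x : T) :
  (\forall y \near x, f y = g y) ->
  {for x, continuous f} -> {for x, continuous g}.
Proof.
move=> fg; rewrite /prop_for /continuous_at => cf.
rewrite -(nbhs_singleton fg); apply: cvg_trans cf.
by apply: near_eq_cvg; apply: filterS fg => y ->.
Qed.

Lemma near_near (T : topologicalType) (x : T) (P : T -> Prop) :
  (\forall y \near x, P y) -> \forall y \near x, \forall z \near y, P z.
Proof.
move=> /nbhs_interior; apply: filterS => y.
by rewrite /interior.
Qed.

Lemma Ck_at_eq V W k (x : V) (f g : V -> W) :
  (\forall y \near x, f y = g y) -> Ck_at k x f -> Ck_at k x g.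
Proof.
elim: k f g => [|k IH] f g /near_near fg /=.
  by apply: filterS2 fg => y; apply: near_eq_for_continuous.
move=> [df Df]; split.
  by apply: filterS2 fg df => y; apply: near_eq_differentiable.
by move=> v; apply: IH (Df v); apply: filterS fg => y; apply: near_eq_derive.
Qed.

Lemma Ck_atS V W k (x : V) (f : V -> W) : Ck_at k.+1 x f -> Ck_at k x f.
Proof.
elim: k f => [|k IH] f [df Df].
  by apply: filterS df => y; apply: differentiable_continuous.
by split=> // v; apply: IH.
Qed.

Lemma Ck_at_continuous V W k (x : V) (f : V -> W) :
  Ck_at k x f -> {for x, continuous f}.
Proof.
case: k => [|k] /=; first exact: nbhs_singleton.
by move=> [/nbhs_singleton df _]; apply: differentiable_continuous.
Qed.

Lemma Ck_at_cst V W k (x : V) (a : W) : Ck_at k x (cst a).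
Proof.
elim: k a => [|k IH] a /=.
  by apply: nearW => y; apply: cst_continuous.
split; first by apply: nearW => y; apply: differentiable_cst.
move=> v; apply: Ck_at_eq (IH 0); apply: nearW => y.
by rewrite derive_cst.
Qed.

Lemma Ck_atD V W k (x : V) (f g : V -> W) :
  Ck_at k x f -> Ck_at k x g -> Ck_at k x (f \+ g).
Proof.
elim: k f g => [|k IH] f g /=.
  by apply: filterS2 => y; apply: continuousD.
move=> [df Df] [dg Dg]; split.
  by apply: filterS2 df dg => y; apply: differentiableD.
move=> v; apply: Ck_at_eq (IH _ _ (Df v) (Dg v)).
apply: filterS2 df dg => y dfy dgy /=.
by rewrite -deriveD//; apply: diff_derivable.
Qed.

Lemma Ck_atM V k (x : V) (f g : V -> R^o) :
  Ck_at k x f -> Ck_at k x g -> Ck_at k x (fun y => f y * g y : R^o).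
Proof.
elim: k f g => [|k IH] f g /=.
  by apply: filterS2 => y; apply: continuousM.
move=> [df Df] [dg Dg]; split.
  by apply: filterS2 df dg => y; apply: differentiableM.
move=> v.
have fD := IH _ _ (Ck_atS (conj df Df)) (Dg v).
have gD := IH _ _ (Ck_atS (conj dg Dg)) (Df v).
apply: Ck_at_eq (Ck_atD fD gD); apply: filterS2 df dg => y dfy dgy /=.
by rewrite -[RHS]/('D_v (f * g) y) deriveM//; apply: diff_derivable.
Qed.

(** The derivative of [1 / f] is a product of [- 1], two factors [1 / f] and the derivative of [f],
    all of class [k] by induction. Non-vanishing is first spread to a neighbourhood, the form in
    which the induction uses it. *)
Lemma Ck_atV V k (x : V) (f : V -> R^o) :
  Ck_at k x f -> f x != 0 -> Ck_at k x (fun y => (f y)^-1 : R^o).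
Proof.
move=> Cf fx0.
have : \forall y \near x, f y != 0.
  have := Ck_at_continuous Cf; rewrite /prop_for /continuous_at => /(_ [set z | z != 0]).
  by apply; apply: open_nbhs_nbhs; split; [exact: open_neq|].
elim: k f Cf {fx0} => [|k IH] f /= Cf f0.
  by apply: filterS2 Cf f0 => y cf fy0; apply: continuousV.
have [df Df] := Cf; split.
  by apply: filterS2 df f0 => y dfy fy0; apply: differentiableV.
move=> v; have CV := IH _ (Ck_atS Cf) f0.
apply: Ck_at_eq (Ck_atM (Ck_at_cst k x (- 1 : R^o)) (Ck_atM (Ck_atM CV CV) (Df v))).
apply: filterS2 df f0 => y dfy fy0 /=.
rewrite -[RHS]/('D_v (fun y => (f y)^-1) y) deriveV//; last exact: diff_derivable.
by rewrite /cst mulN1r -invfM scaleNr.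
Qed.

Lemma Ck_at_sum V (I : Type) (r : seq I) k (x : V) (f : I -> V -> R^o) :
  (forall i, Ck_at k x (f i)) -> Ck_at k x (fun y => \sum_(i <- r) f i y).
Proof.
move=> Cf; elim: r => [|i r IH].
  by apply: Ck_at_eq (Ck_at_cst k x 0); apply: nearW => y; rewrite big_nil.
apply: Ck_at_eq (Ck_atD (Cf i) IH); apply: nearW => y.
by rewrite big_cons.
Qed.

Lemma Ck_at_coord V m k (x : V) (f : V -> 'rV[R]_m) j :
  Ck_at k x f -> Ck_at k x (fun y => f y 0 j : R^o).
Proof.
elim: k f => [|k IH] f /=.
  apply: filterS => y cf.
  exact: (continuous_comp cf (@coord_continuous R 1 m 0 j (f y))).
move=> [df Df]; split.
  apply: filterS df => y dfy.
  apply: (@differentiable_comp _ _ _ _ f (fun w : 'rV[R]_m => w 0 j : R^o)) => //.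
  exact: differentiable_coord.
move=> v; apply: Ck_at_eq (IH _ (Df v)).
apply: filterS df => y dfy; rewrite derive_mx ?mxE//.
exact: diff_derivable.
Qed.

(** The direction ['D_v g x] varies with [x], whereas [Ck_at] controls the derivatives of [f] along
    fixed vectors; hence the chain rule is written in coordinates. *)
Lemma derive_comp_coord V m (x v : V) (f : 'rV[R]_m -> R^o) (g : V -> 'rV[R]_m) :
  differentiable g x -> differentiable f (g x) ->
  'D_v (f \o g) x = \sum_j 'D_v g x 0 j * 'D_(delta_mx 0 j) f (g x).
Proof.
move=> dg df.
rewrite deriveE; last exact: differentiable_comp.
rewrite diff_comp//= -[ 'd g x v]deriveE// [in LHS](row_sum_delta ('D_v g x)).
rewrite linear_sum.
by apply: eq_bigr => j _; rewrite linearZ/= -deriveE.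
Qed.

Lemma Ck_at_comp V m k (x : V) (f : 'rV[R]_m -> R^o) (g : V -> 'rV[R]_m) :
  Ck_at k x g -> Ck_at k (g x) f -> Ck_at k x (f \o g).
Proof.
elim: k f => [|k IH] f Cg Cf.
  have cg := Ck_at_continuous Cg.
  have {}Cf : \forall y \near x, {for g y, continuous f} by exact: cg Cf.
  by apply: filterS2 Cg Cf => y; apply: continuous_comp.
have cg := Ck_at_continuous Cg.
have [dg Dg] := Cg; have [df Df] := Cf.
have {}df : \forall y \near x, differentiable f (g y) by exact: cg df.
split.
  by apply: filterS2 dg df => y; apply: differentiable_comp.
move=> v.
apply: (@Ck_at_eq _ _ _ _
   (fun y => \sum_j 'D_v g y 0 j * 'D_(delta_mx 0 j) f (g y) : R^o)).
  by apply: filterS2 dg df => y dgy dfy; rewrite derive_comp_coord.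
apply: Ck_at_sum => j; apply: Ck_atM.
  exact: (Ck_at_coord j (Dg v)).
exact: (IH (fun y => 'D_(delta_mx 0 j) f y) (Ck_atS Cg) (Df _)).
Qed.

Lemma Ck_atP V W k (U : set V) (f : V -> W) : open U ->
  Ck k U f <-> forall x, U x -> Ck_at k x f.
Proof.
move=> oU; elim: k f => [|k IH] f /=; split.
- move=> Cf x Ux; have : nbhs x U by apply: open_nbhs_nbhs.
  by apply: filterS => y; apply: Cf.
- by move=> Cf x Ux; have /nbhs_singleton := Cf x Ux.
- move=> [df Df] x Ux; split; last by move=> v; have /IH := Df v; apply.
  have : nbhs x U by apply: open_nbhs_nbhs.
  by apply: filterS => y; apply: df.
- move=> Cf; split; first by move=> x Ux; have [/nbhs_singleton] := Cf x Ux.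
  by move=> v; apply/IH => x Ux; have [_] := Cf x Ux.
Qed.

Definition Cinfty_at V W (x : V) (f : V -> W) := forall k, Ck_at k x f.

Lemma Cinfty_atP V W (U : set V) (f : V -> W) : open U ->
  Cinfty U f <-> forall x, U x -> Cinfty_at x f.
Proof.
move=> oU; split=> [Cf x Ux k|Cf k]; last by apply/Ck_atP => // x /Cf.
by have /Ck_atP := Cf k; apply.
Qed.

End CkAt.

(** * Smooth families of linear maps *)

Section SmoothFunctions.
Context (R : realType).
Implicit Types M N : manifold R.

Definition smooth_at N (z : N) (f : N -> R) :=
  forall c, atlas N c -> cdom c z -> Cinfty_at (c z) ((f \o cinv c) : _ -> R^o).

Lemma chart_near N (c : chart R N (mdim N)) (z : N) (P : N -> Prop) :
  cdom c z -> (\forall y \near z, P y) -> \forall w \near c z, P (cinv c w).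
Proof.
move=> cz; have := @cinv_continuous R N (mdim N) c (c z); rewrite /prop_for /continuous_at.
by rewrite cfunK// => h; apply: h; exists z.
Qed.

Lemma chart_image_open N (c : chart R N (mdim N)) (W : set N) :
  open W -> open (c @` (cdom c `&` W)).
Proof.
move=> oW; rewrite openE => _ [z [cz Wz] <-].
have cW : \forall w \near c z, W (cinv c w).
  by apply: chart_near cz _; apply: open_nbhs_nbhs.
have cc : \forall w \near c z, (c @` cdom c) w.
  by apply: open_nbhs_nbhs; split; [exact: cimg_open|exists z].
by apply: filterS2 cc cW => _ [y cy <-]; rewrite cfunK// => Wy; exists y.
Qed.

Lemma smooth_onP N (W : set N) (f : N -> R) : open W ->
  smooth_on W f <-> forall z, W z -> smooth_at z f.
Proof.
move=> oW; split=> [Wf z Wz c ac cz|Wf c ac].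
  have := Wf c ac => /(Cinfty_atP _ (chart_image_open (c := c) oW)); apply.
  by exists z.
apply/(Cinfty_atP _ (chart_image_open (c := c) oW)) => _ [z [cz Wz] <-].
exact: Wf.
Qed.

Lemma smooth_at_eq N (z : N) (f g : N -> R) :
  (\forall y \near z, f y = g y) -> smooth_at z f -> smooth_at z g.
Proof.
move=> fg sf c ac cz k; apply: Ck_at_eq (sf c ac cz k).
exact: (chart_near cz fg).
Qed.

Lemma smooth_at_cst N (z : N) (a : R) : smooth_at z (cst a).
Proof. by move=> c ac cz k; exact: Ck_at_cst. Qed.

Lemma smooth_atD N (z : N) (f g : N -> R) :
  smooth_at z f -> smooth_at z g -> smooth_at z (fun y => f y + g y).
Proof. by move=> sf sg c ac cz k; apply: Ck_atD; [apply: sf|apply: sg]. Qed.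

Lemma smooth_atM N (z : N) (f g : N -> R) :
  smooth_at z f -> smooth_at z g -> smooth_at z (fun y => f y * g y).
Proof. by move=> sf sg c ac cz k; apply: Ck_atM; [apply: sf|apply: sg]. Qed.

Lemma smooth_atV N (z : N) (f : N -> R) :
  smooth_at z f -> f z != 0 -> smooth_at z (fun y => (f y)^-1).
Proof.
move=> sf fz c ac cz k; apply: Ck_atV; first exact: sf.
by rewrite /= cfunK.
Qed.

Lemma smooth_at_sum N (z : N) (I : Type) (r : seq I) (P : pred I) (f : I -> N -> R) :
  (forall i, smooth_at z (f i)) -> smooth_at z (fun y => \sum_(i <- r | P i) f i y).
Proof.
move=> sf; elim: r => [|i r IH].
  apply: (@smooth_at_eq N z _ _ _ (@smooth_at_cst N z 0)); apply: nearW => y.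
  by rewrite big_nil.
case Pi : (P i); last first.
  by apply: (smooth_at_eq _ IH); apply: nearW => y; rewrite big_cons Pi.
apply: (smooth_at_eq _ (smooth_atD (sf i) IH)).
by apply: nearW => y; rewrite big_cons Pi.
Qed.

Lemma smooth_at_prod N (z : N) (I : Type) (r : seq I) (P : pred I) (f : I -> N -> R) :
  (forall i, smooth_at z (f i)) -> smooth_at z (fun y => \prod_(i <- r | P i) f i y).
Proof.
move=> sf; elim: r => [|i r IH].
  by apply: (@smooth_at_eq N z _ _ _ (@smooth_at_cst N z 1)); apply: nearW => y; rewrite big_nil.
case Pi : (P i); last first.
  by apply: (smooth_at_eq _ IH); apply: nearW => y; rewrite big_cons Pi.
apply: (smooth_at_eq _ (smooth_atM (sf i) IH)).
by apply: nearW => y; rewrite big_cons Pi.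
Qed.

Lemma smooth_at_neq0 N (z : N) (f : N -> R) :
  smooth_at z f -> f z != 0 -> \forall y \near z, f y != 0.
Proof.
move=> sf fz; have [c ac cz] := atlas_cover z.
have fc := Ck_at_continuous (sf c ac cz 0%N).
have : \forall w \near c z, f (cinv c w) != 0.
  move: fc; rewrite /prop_for /continuous_at /= cfunK//.
  move=> /(_ [set x | x != 0]); apply.
  by apply: open_nbhs_nbhs; split; [exact: open_neq|].
move=> fcz; have h : \forall y \near z, f (cinv c (c y)) != 0.
  exact: (cfun_continuous cz fcz).
have : \forall y \near z, cdom c y.
  by apply: open_nbhs_nbhs; split => //; exact: cdom_open.
by apply: filterS2 h => y fy cy; rewrite cfunK in fy.
Qed.

Lemma smooth_at_comp N M (p : N -> M) (z : N) (f : M -> R) :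
  smooth_map p -> smooth_at (p z) f -> smooth_at z (f \o p).
Proof.
move=> [cp sp] sf c ac cz k; have [d ad dz] := atlas_cover (p z).
have oW : open (p @^-1` cdom d) by apply: open_comp (cdom_open d) => y _; apply: cp.
have /(Cinfty_atP _ (chart_image_open (c := c) oW)) Cd := sp c d ac ad.
have pd : \forall y \near z, cdom d (p y) by apply: open_nbhs_nbhs.
have dom := chart_near cz pd.
have gE : (d \o p \o cinv c) (c z) = d (p z) by rewrite /= cfunK.
apply: (@Ck_at_eq _ _ _ _ _ ((f \o cinv d) \o (d \o p \o cinv c) : _ -> R^o)).
  by apply: filterS dom => w dw /=; rewrite cfunK.
apply: Ck_at_comp; first by apply: Cd; exists z.
by rewrite gE; apply: sf.
Qed.

Definition smooth_mx_at N (z : N) m n (A : N -> 'M[R]_(m, n)) :=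
  forall j k, smooth_at z (fun y => A y j k).

Lemma smooth_mx_at_eq N (z : N) m n (A B : N -> 'M[R]_(m, n)) :
  (\forall y \near z, A y = B y) -> smooth_mx_at z A -> smooth_mx_at z B.
Proof.
move=> AB sA j k; apply: (smooth_at_eq _ (sA j k)).
by apply: filterS AB => y ->.
Qed.

Lemma smooth_mx_atM N (z : N) m n p (A : N -> 'M[R]_(m, n)) (B : N -> 'M[R]_(n, p)) :
  smooth_mx_at z A -> smooth_mx_at z B -> smooth_mx_at z (fun y => A y *m B y).
Proof.
move=> sA sB j k.
apply: (@smooth_at_eq _ _ (fun y => \sum_i A y j i * B y i k)).
  by apply: nearW => y; rewrite mxE.
by apply: smooth_at_sum => i; apply: smooth_atM.
Qed.

Lemma smooth_at_det N (z : N) n (A : N -> 'M[R]_n) :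
  smooth_mx_at z A -> smooth_at z (fun y => \det (A y)).
Proof.
move=> sA; apply: smooth_at_sum => s; apply: smooth_atM; first exact: smooth_at_cst.
by apply: smooth_at_prod => i; apply: sA.
Qed.

(** Cramer's rule. It describes [invmx] only where the determinant is non-zero, which holds near [z]
    by continuity. *)
Lemma smooth_mx_atV N (z : N) n (A : N -> 'M[R]_n) :
  smooth_mx_at z A -> A z \in unitmx -> smooth_mx_at z (fun y => invmx (A y)).
Proof.
rewrite unitmxE unitfE => sA Az j k.
have dA := smooth_at_neq0 (smooth_at_det sA) Az.
apply: (@smooth_at_eq _ _ (fun y => (\det (A y))^-1 * cofactor (A y) k j)).
  by apply: filterS dA => y Ay; rewrite /invmx unitmxE unitfE Ay !mxE.
apply: smooth_atM; first by apply: smooth_atV => //; apply: smooth_at_det.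
apply: smooth_atM; first exact: smooth_at_cst.
apply: smooth_at_det => i l.
by apply: (smooth_at_eq _ (sA (lift k i) (lift j l))); apply: nearW => y; rewrite !mxE.
Qed.

Lemma smooth_mx_at_comp N M (p : N -> M) (z : N) m n (A : M -> 'M[R]_(m, n)) :
  smooth_map p -> smooth_mx_at (p z) A -> smooth_mx_at z (A \o p).
Proof. by move=> sp sA j k; apply: (smooth_at_comp (f := fun x => A x j k) sp); apply: sA. Qed.

Lemma smooth_map_id M : smooth_map (@id M).
Proof. by split=> [z|c d ac ad]; [exact: cvg_id|exact: atlas_compatible]. Qed.

End SmoothFunctions.

(** * Families of linear maps in local frames *)

Section SmoothFamilies.
Context (R : realType).
Implicit Types M N : manifold R.

(** [is_bundle] without smooth transitions. That last clause is itself the smoothness of a family,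
    so the criterion [smooth_familyP] has to be available before it is established. *)
Definition framed M (E : bundle_data M) :=
  (forall e, bframes E e ->
     open (fdom e) /\ forall x, fdom e x -> is_basis (fun k => e k x)) /\
  (forall x, exists2 e, bframes E e & fdom e x).

Definition frame_mx N M (E F : bundle_data M) (p q : N -> M)
    (e : lframe E (brank E)) (f : lframe F (brank F))
    (Phi : forall z, E (p z) -> F (q z)) (z : N) :
    'M[R]_(brank E, brank F) :=
  mxof (fun j => e j (p z)) (fun k => f k (q z)) (Phi z).

Definition smooth_family_at N M (E F : bundle_data M) (p q : N -> M)
    (Phi : forall z, E (p z) -> F (q z)) (z : N) :=
  forall e f, bframes E e -> bframes F f -> fdom e (p z) -> fdom f (q z) ->
  smooth_mx_at z (frame_mx e f Phi).

Lemma framed_near N M (E : bundle_data M) (p : N -> M) e (z : N) :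
  framed E -> continuous p -> bframes E e -> fdom e (p z) ->
  \forall y \near z, fdom e (p y) /\ is_basis (fun k => e k (p y)).
Proof.
move=> [fE _] cp Ee ez; have [oe be] := fE e Ee.
have : \forall y \near z, fdom e (p y) by apply: cp; apply: open_nbhs_nbhs.
by apply: filterS => y ey; split => //; apply: be.
Qed.

Lemma smooth_familyP N M (E F : bundle_data M) (p q : N -> M)
    (Phi : forall z, E (p z) -> F (q z)) :
  framed E -> framed F -> continuous p -> continuous q ->
  smooth_family Phi <-> forall z, smooth_family_at Phi z.
Proof.
move=> fE fF cp cq.
have oW e f : bframes E e -> bframes F f ->
    open (p @^-1` fdom e `&` q @^-1` fdom f).
  move=> Ee Ff; have [oe _] := fE.1 e Ee; have [of_ _] := fF.1 f Ff.
  by apply: openI; [apply: (open_comp _ oe)|apply: (open_comp _ of_)] => y _;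
    [apply: cp|apply: cq].
split=> [sP z e f Ee Ff ez fz j k|sP e f Ee Ff W].
  have [a [sa Pa]] := sP e f Ee Ff.
  have /(smooth_onP _ (oW e f Ee Ff))/(_ z (conj ez fz)) := sa j k.
  apply: smooth_at_eq; apply: filterS2 (framed_near fE cp Ee ez) (framed_near fF cq Ff fz).
  move=> y [ey _] [fy bf].
  rewrite /frame_mx (mxof_uniq (A := \matrix_(j, k) a j k y) bf) ?mxE// => i.
  by rewrite Pa//; apply: eq_bigr => l _; rewrite mxE.
exists (fun j k z => frame_mx e f Phi z j k); split=> [j k|z [ez fz] j].
  by apply/(smooth_onP _ (oW e f Ee Ff)) => z [ez fz]; apply: sP.
have [_ /(_ _ fz) bf] := fF.1 f Ff.
exact: (mxofE _ _ _ bf).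
Qed.

Lemma vbundle_framed M (E : vbundle M) : framed E.
Proof. by have [fE cE _] := vbP E. Qed.

Lemma smooth_family_at_eq N M (E F : bundle_data M) (p q : N -> M)
    (Phi Psi : forall z, E (p z) -> F (q z)) (z : N) :
  (\forall y \near z, Phi y =1 Psi y) ->
  smooth_family_at Phi z -> smooth_family_at Psi z.
Proof.
move=> PP sP e f Ee Ff ez fz; apply: (smooth_mx_at_eq _ (sP e f Ee Ff ez fz)).
by apply: filterS PP => y Py; apply: eq_mxof.
Qed.

Lemma smooth_family_at_comp N M (E F G : bundle_data M) (p q r : N -> M)
    (Phi : forall z, E (p z) -> F (q z))
    (Psi : forall z, {linear F (q z) -> G (r z)}) (z : N) :
  framed F -> framed G -> continuous q -> continuous r ->
  smooth_family_at Phi z -> smooth_family_at Psi z ->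
  smooth_family_at (fun y => Psi y \o Phi y) z.
Proof.
move=> fF fG cq cr sP sQ e g Ee Gg ez gz.
have [f Ff fz] := fF.2 (q z).
apply: (smooth_mx_at_eq _ (smooth_mx_atM (sP e f Ee Ff ez fz) (sQ f g Ff Gg fz gz))).
apply: filterS2 (framed_near fF cq Ff fz) (framed_near fG cr Gg gz).
by move=> y [_ bf] [_ bg]; rewrite /frame_mx -mxof_comp.
Qed.

Lemma smooth_family_atD N M (E F : bundle_data M) (p q : N -> M)
    (Phi Psi : forall z, E (p z) -> F (q z)) (z : N) :
  framed F -> continuous q ->
  smooth_family_at Phi z -> smooth_family_at Psi z ->
  smooth_family_at (fun y => Phi y \+ Psi y) z.
Proof.
move=> fF cq sP sQ e f Ee Ff ez fz j k.
apply: (smooth_at_eq _ (smooth_atD (sP e f Ee Ff ez fz j k) (sQ e f Ee Ff ez fz j k))).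
apply: filterS (framed_near fF cq Ff fz) => y [_ bf].
by rewrite /frame_mx mxofD// [in RHS]mxE.
Qed.

Lemma smooth_family_at_pullback N M (E F : bundle_data M) (p : N -> M)
    (Phi : forall x, E x -> F x) (z : N) :
  smooth_map p -> @smooth_family_at M M E F id id Phi (p z) ->
  @smooth_family_at N M E F p p (fun y => Phi (p y)) z.
Proof.
move=> sp sP e f Ee Ff ez fz.
exact: (smooth_mx_at_comp sp (sP e f Ee Ff ez fz)).
Qed.

Lemma bundle_transition M (E : bundle_data M) (x : M) : is_bundle E ->
  @smooth_family_at M M E E id id (fun _ => id) x.
Proof.
move=> [fE cE sE]; have fr : framed E by [].
have idc : continuous (@id M) by move=> y; exact: cvg_id.
exact: ((@smooth_familyP M M E E id id (fun _ => id) fr fr idc idc).1 sE x).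
Qed.

(** Any other pair of frames changes the matrix by factors on both sides: transition matrices pulled
    back along [p] and [q], which are smooth. *)
Lemma smooth_family_at_frames N M (E F : bundle_data M) (p q : N -> M)
    (Phi : forall z, {linear E (p z) -> F (q z)}) (z : N) e0 f0 :
  is_bundle E -> is_bundle F -> smooth_map p -> smooth_map q ->
  bframes E e0 -> bframes F f0 -> fdom e0 (p z) -> fdom f0 (q z) ->
  smooth_mx_at z (frame_mx e0 f0 Phi) -> smooth_family_at Phi z.
Proof.
move=> bE bF sp sq Ee0 Ff0 ez0 fz0 s0 e f Ee Ff ez fz.
have [fE cE _] := bE; have [fF cF _] := bF.
have sid (G : bundle_data M) (r : N -> M) : is_bundle G -> smooth_map r ->
    @smooth_family_at N M G G r r (fun _ => id) z.
  move=> bG sr; apply: (smooth_family_at_pullback (Phi := fun _ => id) sr).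
  exact: bundle_transition.
have s1 := sid E p bE sp e e0 Ee Ee0 ez ez0.
have s2 := sid F q bF sq f0 f Ff0 Ff fz0 fz.
apply: (smooth_mx_at_eq _ (smooth_mx_atM (smooth_mx_atM s1 s0) s2)).
have n1 := framed_near (conj fE cE) sp.1 Ee0 ez0.
have n2 := framed_near (conj fF cF) sq.1 Ff0 fz0.
have n3 := framed_near (conj fF cF) sq.1 Ff fz.
apply: filterS3 n1 n2 n3 => y [_ be0] [_ bf0] [_ bf].
rewrite /frame_mx -(mxof_comp _ _ (Phi y) be0 bf0).
by rewrite -(mxof_comp _ _ (idfun : {linear F (q y) -> F (q y)}) bf0 bf).
Qed.

End SmoothFamilies.

(** * Direct sums of bundles *)

Lemma near_finite_set (T : topologicalType) (x : T) (I : choiceType) (S : set I)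
    (P : I -> T -> Prop) : finite_set S ->
  (forall i, S i -> \forall y \near x, P i y) ->
  \forall y \near x, forall i, S i -> P i y.
Proof.
move=> finS SP.
suff : nbhs x (\bigcap_(i in S) P i) by [].
rewrite -(fset_setK finS).
by apply: filter_bigI => i; rewrite in_fset_set// inE => /SP.
Qed.

Section DsumBundle.
Context (R : realType) (M : manifold R) (E : int -> vbundle M).
Hypothesis finE : finite_set [set i | brank (E i) <> 0%N].

Let D : bundle_data M := dsum_bundle (fun i => E i).
Context (phi : 'I_(brank D) -> {i : int & 'I_(brank (E i))}).
Context (psi : {i : int & 'I_(brank (E i))} -> 'I_(brank D)).
Hypothesis idx : dsum_index phi psi.

Lemma brank_index k : brank (E (tag (phi k))) <> 0%N.
Proof. by move=> E0; case: (tagged (phi k)) => m; rewrite E0. Qed.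

Section StandardFrame.
Context (eps : forall i, lframe (E i) (brank (E i))).
Hypothesis eps_frame : forall i, bframes (E i) (eps i).

(** Only the summands of non-zero rank restrict the domain: they are finitely many, so the
    intersection stays open. *)
Definition dsum_std_frame : lframe D (brank D) :=
  Frame [set x | forall i, brank (E i) <> 0%N -> fdom (eps i) x]
    (fun k x => dsum_frame (fun i j => eps i j x) phi k).

Lemma std_frame_in k x :
  submod_val (dsum_std_frame k x) (tag (phi k)) =
  eps (tag (phi k)) (tagged (phi k)) x.
Proof. exact: dsum_single_in. Qed.

Lemma std_frame_out k i x : tag (phi k) != i ->
  submod_val (dsum_std_frame k x) i = 0.
Proof. exact: dsum_single_out. Qed.

(* Outside the support of [E] the fibres are zero and any frame will do. *)
Lemma eps_basis i x : fdom dsum_std_frame x -> is_basis (fun j => eps i j x).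
Proof.
move=> Ux; have [Ei0|/eqP Ei] := eqVneq (brank (E i)) 0%N; last first.
  by have [_ b] := (vbundle_framed (E i)).1 _ (eps_frame i); apply/b/Ux.
have [e Ee ex] := (vbundle_framed (E i)).2 x.
have [_ /(_ x ex)] := (vbundle_framed (E i)).1 _ Ee.
suff -> : (fun k => e k x) = (fun j => eps i j x) by [].
by apply/funext => -[k kE]; exfalso; rewrite Ei0 in kE.
Qed.

Lemma std_frame_open : open (fdom dsum_std_frame).
Proof.
rewrite openE => x Ux; apply: near_finite_set => // i /= Ei.
have [oe _] := (vbundle_framed (E i)).1 _ (eps_frame i).
by apply: open_nbhs_nbhs; split => //; apply: Ux.
Qed.

Lemma std_frame_basis x : fdom dsum_std_frame x ->
  is_basis (fun k => dsum_std_frame k x).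
Proof.
move=> Ux; apply: (dsum_frame_basis idx) => i; exact: eps_basis.
Qed.

Lemma std_frame_coords x (v : dsum (fun i => E i x)) k : fdom dsum_std_frame x ->
  coords (fun k => dsum_std_frame k x) v 0 k =
  coords (fun j => eps (tag (phi k)) j x) (submod_val v (tag (phi k))) 0 (tagged (phi k)).
Proof.
move=> Ux; have [phiK psiK] := idx.
pose a := coords (fun k => dsum_std_frame k x) v.
have vE : v = \sum_k a 0 k *: dsum_std_frame k x by apply: coordsE; exact: std_frame_basis.
have := dsum_frame_sum (fun i j => eps i j x) idx (fun k => a 0 k) (tag (phi k)).
rewrite -[X in submod_val X]vE => vi.
rewrite (coords_uniq (a := \row_j a 0 (psi (Tagged _ j))) (eps_basis Ux)).
  by rewrite mxE -/a; congr (a _ _); rewrite -[LHS]phiK; congr psi; case: (phi k).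
by rewrite vi; apply: eq_bigr => j _; rewrite mxE.
Qed.

End StandardFrame.

Lemma smooth_section_at (F : vbundle M) (U : set M) s e x k :
  open U -> smooth_section (E := F) U s -> U x -> bframes F e -> fdom e x ->
  smooth_at x (fun y => coords (fun j => e j y) (s y) 0 k).
Proof.
move=> oU ss Ux Fe ex; have [a [sa sE]] := ss e Fe.
have [oe be] := (vbundle_framed F).1 e Fe.
have /(smooth_onP _ (openI oU oe))/(_ x (conj Ux ex)) := sa k.
have n1 : \forall y \near x, U y by apply: open_nbhs_nbhs.
have n2 : \forall y \near x, fdom e y by apply: open_nbhs_nbhs.
apply: smooth_at_eq; apply: filterS2 n1 n2 => y Uy ey.
rewrite (coords_uniq (a := \row_k a k y) (be y ey)) ?mxE// sE//.
by apply: eq_bigr => j _; rewrite mxE.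
Qed.

Lemma smooth_section_of_at (F : vbundle M) (U : set M) s :
  open U -> (forall e x k, U x -> bframes F e -> fdom e x ->
    smooth_at x (fun y => coords (fun j => e j y) (s y) 0 k)) ->
  smooth_section (E := F) U s.
Proof.
move=> oU ss e Fe; have [oe be] := (vbundle_framed F).1 e Fe.
exists (fun k y => coords (fun j => e j y) (s y) 0 k); split=> [k|x Ux ex].
  by apply/(smooth_onP _ (openI oU oe)) => x [Ux ex]; apply: ss.
exact/coordsE/be.
Qed.

Lemma std_frame_bframes eps : (forall i, bframes (E i) (eps i)) ->
  bframes D (dsum_std_frame eps).
Proof.
move=> He; split.
- exact: std_frame_open.
- by move=> x; apply: std_frame_basis.
move=> k i; apply: smooth_section_of_at; first exact: std_frame_open.
move=> e x l Ux Ee ex.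
have [be bx] : [/\ forall y, fdom e y -> is_basis (fun j => e j y) & open (fdom e)].
  by have [] := (vbundle_framed (E i)).1 e Ee.
have ne : \forall y \near x, fdom e y by apply: open_nbhs_nbhs.
have [ki|ki] := eqVneq (tag (phi k)) i.
  subst i.
  have := @bundle_transition R M _ x (vbP (E (tag (phi k)))).
  move=> /(_ _ _ (He _) Ee (Ux _ (@brank_index k)) ex (tagged (phi k)) l).
  apply: smooth_at_eq; apply: nearW => y.
  by rewrite /frame_mx mxE std_frame_in.
apply: (@smooth_at_eq _ _ x _ _ _ (@smooth_at_cst R M x 0)).
apply: filterS ne => y ey; rewrite std_frame_out//.
rewrite (coords_uniq (a := 0) (be y ey)) ?mxE// big1// => j _.
by rewrite mxE scale0r.
Qed.

Lemma std_frame_exists x : exists2 eps, forall i, bframes (E i) (eps i) &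
  fdom (dsum_std_frame eps) x.
Proof.
have h i : exists e : lframe (E i) (brank (E i)), bframes (E i) e /\ fdom e x.
  by have [e Ee ex] := (vbundle_framed (E i)).2 x; exists e.
pose eps i := projT1 (cid (h i)).
have epsP i : bframes (E i) (eps i) /\ fdom (eps i) x by rewrite /eps; case: cid.
by exists eps => i; have [] := epsP i.
Qed.

Lemma dsum_framed : framed D.
Proof.
split=> [e [oe be _]|x]; first by split.
have [eps He Ux] := std_frame_exists x.
by exists (dsum_std_frame eps) => //; apply: std_frame_bframes.
Qed.

Lemma std_frame_transition eps e x : (forall i, bframes (E i) (eps i)) ->
  bframes D e -> fdom (dsum_std_frame eps) x -> fdom e x ->
  smooth_mx_at x (@frame_mx R M M D D id id e (dsum_std_frame eps) (fun _ => id)).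
Proof.
move=> He [oe be se] Ux ex j k.
pose i := tag (phi k).
have sk := smooth_section_at (tagged (phi k)) oe (se j i) ex (He i) (Ux i (@brank_index k)).
apply: (@smooth_at_eq _ _ x _ _ _ sk).
have nU : \forall y \near x, fdom (dsum_std_frame eps) y.
  by apply: open_nbhs_nbhs; split => //; apply: std_frame_open.
by apply: filterS nU => y Uy; rewrite /frame_mx mxE std_frame_coords.
Qed.

(** Frames are defined by smooth components, which makes the passage from any frame to a standard
    one smooth. The way back is obtained by inverting that matrix, and two arbitrary frames are
    compared through a standard one. *)
Lemma dsum_is_bundle : is_bundle D.
Proof.
have fD := dsum_framed; split; [exact: fD.1|exact: fD.2|].
have idc : continuous (@id M) by move=> y; exact: cvg_id.
apply/(smooth_familyP _ fD fD idc idc) => x e f De Df ex fx.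
have [eps He Ux] := std_frame_exists x.
have Ds := std_frame_bframes He.
have se := std_frame_transition He De Ux ex.
have sf := std_frame_transition He Df Ux fx.
have nU := framed_near fD idc Ds Ux.
have nf := framed_near fD idc Df fx.
pose trans (e1 e2 : lframe D (brank D)) :=
  @frame_mx R M M D D id id e1 e2 (fun _ => id).
have inv : \forall y \near x,
    trans f (dsum_std_frame eps) y *m
    trans (dsum_std_frame eps) f y = 1%:M.
  apply: filterS2 nU nf => y [_ bs] [_ bf].
  by rewrite /trans /frame_mx -(mxof_comp _ _ (idfun : {linear D y -> D y}) bs bf) mxof_id.
have unit_f : \forall y \near x,
    trans f (dsum_std_frame eps) y \in unitmx.
  by apply: filterS inv => y /mulmx1_unit[].
have sV := smooth_mx_atV sf (nbhs_singleton unit_f).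
apply: (smooth_mx_at_eq _ (smooth_mx_atM se sV)).
apply: filterS3 nU nf (filterI inv unit_f) => y [_ bs] [_ bf] [iy uy].
have -> : invmx (trans f (dsum_std_frame eps) y) =
    trans (dsum_std_frame eps) f y.
  by rewrite -[LHS]mulmx1 -iy mulKmx.
by rewrite /trans /frame_mx -(mxof_comp _ _ (idfun : {linear D y -> D y}) bs bf).
Qed.

(** In standard frames the matrix is block diagonal: entries between different summands vanish, the
    others are entries of a single [Phi y i]. *)
Lemma dsum_map_smooth (N : manifold R) (p q : N -> M)
    (Phi : forall z i, {linear E i (p z) -> E i (q z)}) z :
  smooth_map p -> smooth_map q ->
  (forall i, smooth_family_at (fun y => Phi y i) z) ->
  @smooth_family_at R N M D D p q (fun y => dsum_map (Phi y)) z.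
Proof.
move=> sp sq sPhi; have fD := dsum_framed.
have [eps He Ux] := std_frame_exists (p z).
have [eta Hf Vx] := std_frame_exists (q z).
have De := std_frame_bframes He; have Df := std_frame_bframes Hf.
apply: (@smooth_family_at_frames R N M D D p q (fun y => dsum_map (Phi y)) z
  _ _ dsum_is_bundle dsum_is_bundle sp sq De Df Ux Vx) => k l.
have nf := framed_near fD sq.1 Df Vx.
have ne := framed_near fD sp.1 De Ux.
have [kl|kl] := eqVneq (tag (phi k)) (tag (phi l)); last first.
  apply: (@smooth_at_eq _ _ z _ _ _ (@smooth_at_cst R N z 0)).
  apply: filterS nf => y [Vy _].
  have e0 : submod_val (dsum_map (Phi y) (dsum_std_frame eps k (p y))) (tag (phi l)) = 0.
    rewrite [LHS]/(Phi y _ (submod_val (dsum_std_frame eps k (p y)) _)).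
    by rewrite std_frame_out//; exact: linear0.
  rewrite /frame_mx mxE std_frame_coords//.
  rewrite (coords_uniq (a := 0) (eps_basis Hf Vy)) ?mxE// big1; first exact: e0.
  by move=> j _; rewrite mxE scale0r.
have El := @brank_index l.
have := sPhi (tag (phi l)) _ _ (He _) (Hf _) (Ux _ El) (Vx _ El).
(* [j] is the index of [k] within its summand, read as an index for the summand of [l]. *)
have [j jE] : exists j : 'I_(brank (E (tag (phi l)))), forall y,
    submod_val (dsum_std_frame eps k y) (tag (phi l)) = eps (tag (phi l)) j y.
  by rewrite -kl; exists (tagged (phi k)) => y; rewrite std_frame_in.
move=> /(_ j (tagged (phi l))); apply: smooth_at_eq.
apply: filterS nf => y [Vy _].
rewrite /frame_mx !mxE std_frame_coords//.
by congr (coords _ _ _ _); rewrite -jE.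
Qed.

End DsumBundle.

(** * The Berezinian bundle *)

Lemma finite_set_bounded_int (S : set int) (N : nat) :
  (forall i, S i -> `|i| <= N%:Z) -> finite_set S.
Proof.
move=> SN; apply: (@sub_finite_set _ _ ((fun k : nat => k%:Z - N%:Z) @` `I_(N + N).+1)).
  move=> i /SN; rewrite ler_norml => /andP[Ni iN].
  exists `|(i + N%:Z)%R|%N; first by rewrite /=; lia.
  by rewrite gez0_abs; lia.
exact/finite_image/finite_II.
Qed.

Lemma unitmx_linear_inverse (F : fieldType) (V W : lmodType F) n
    (e : 'I_n -> V) (e' : 'I_n -> W) (f : {linear V -> W}) :
  is_basis e -> is_basis e' -> mxof e e' f \in unitmx ->
  exists f' : {linear W -> V}, cancel f f' /\ cancel f' f.
Proof.
move=> be be' uf; have [f' f'E] := linear_of_mx e (invmx (mxof e e' f)) be'.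
have Mf' := mxof_uniq be f'E.
exists f'; split.
  suff : (f' \o f) =1 idfun by [].
  apply: (linear_basis_eq be) => k.
  rewrite [LHS](mxofE e (f' \o f) k be) [RHS](mxofE e idfun k be).
  by rewrite (mxof_comp e f f' be' be) Mf' mulmxV// mxof_id.
suff : (f \o f') =1 idfun by [].
apply: (linear_basis_eq be') => k.
rewrite [LHS](mxofE e' (f \o f') k be') [RHS](mxofE e' idfun k be').
by rewrite (mxof_comp e' f' f be be') Mf' mulVmx// mxof_id.
Qed.

Section BerBundle.
Context (R : realType) (M : manifold R) (E : vcomplex M).

Lemma vcomplex_finite (c : int) :
  finite_set [set i : int | brank (E (2 * i + c)) <> 0%N].
Proof.
have [N EN] := vbounded E.
(* The bound comes from [|i| <= |2 i| <= |2 i + c| + |c|]. *)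
apply: (@finite_set_bounded_int _ (N + `|c|)%N) => i /= Ei.
have [/EN//|] := ltP N%:Z `|2 * i + c|.
lia.
Qed.

Lemma ev_is_bundle : is_bundle (ev_bundle E).
Proof.
have fin : finite_set [set i : int | brank (E (2 * i)) <> 0%N].
  by have := vcomplex_finite 0; under eq_set do rewrite addr0.
have [phi [psi idx]] := dsum_index_exists fin.
exact: (@dsum_is_bundle R M (fun i => E (2 * i)) fin phi psi idx).
Qed.

Lemma od_is_bundle : is_bundle (od_bundle E).
Proof.
have fin := vcomplex_finite 1.
have [phi [psi idx]] := dsum_index_exists fin.
exact: (@dsum_is_bundle R M (fun i => E (2 * i + 1)) fin phi psi idx).
Qed.

Lemma ev_map_smooth (N : manifold R) (p q : N -> M) z
    (f : forall z, chain_map (fiber_complex E (p z)) (fiber_complex E (q z))) :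
  smooth_map p -> smooth_map q ->
  (forall i, @smooth_family_at R N M (E i) (E i) p q (fun y => f y i) z) ->
  @smooth_family_at R N M (ev_bundle E) (ev_bundle E) p q (fun y => ev_map (f y)) z.
Proof.
move=> sp sq sf.
have fin : finite_set [set i : int | brank (E (2 * i)) <> 0%N].
  by have := vcomplex_finite 0; under eq_set do rewrite addr0.
have [phi [psi idx]] := dsum_index_exists fin.
exact: (@dsum_map_smooth R M (fun i => E (2 * i)) fin phi psi idx N p q
  (fun y i => f y (2 * i)) z sp sq (fun i => sf (2 * i))).
Qed.

Lemma od_map_smooth (N : manifold R) (p q : N -> M) z
    (f : forall z, chain_map (fiber_complex E (p z)) (fiber_complex E (q z))) :
  smooth_map p -> smooth_map q ->
  (forall i, @smooth_family_at R N M (E i) (E i) p q (fun y => f y i) z) ->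
  @smooth_family_at R N M (od_bundle E) (od_bundle E) p q (fun y => od_map (f y)) z.
Proof.
move=> sp sq sf; have fin := vcomplex_finite 1.
have [phi [psi idx]] := dsum_index_exists fin.
exact: (@dsum_map_smooth R M (fun i => E (2 * i + 1)) fin phi psi idx N p q
  (fun y i => f y (2 * i + 1)) z sp sq (fun i => sf (2 * i + 1))).
Qed.

Lemma bundle_framed (B : bundle_data M) : is_bundle B -> framed B.
Proof. by case. Qed.

Lemma ber_frameP (b : lframe (ber_bundle E) 1) : bframes (ber_bundle E) b ->
  exists e f f', [/\ bframes (ev_bundle E) e, bframes (od_bundle E) f,
    fdom b = fdom e `&` fdom f &
    forall x, fdom b x -> dual_family (fun k => f k x) (f' x) /\
      forall k, b k x = ber_frame e f' x].
Proof. exact. Qed.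

Lemma ber_frame_is_basis (e : lframe (ev_bundle E) (brank (ev_bundle E)))
    (f : lframe (od_bundle E) (brank (od_bundle E)))
    (f' : forall x, 'I_(brank (od_bundle E)) -> dualmod (od_bundle E x)) x :
  is_basis (fun k => e k x) -> is_basis (fun k => f k x) ->
  dual_family (fun k => f k x) (f' x) ->
  @is_basis R (ber_bundle E x) 1 (fun _ => ber_frame e f' x).
Proof.
exact: (@ber_frame_basis R (fiber_complex E x) _ _
  (fun k => e k x) (fun k => f k x) (f' x)).
Qed.

Lemma ber_framed : framed (ber_bundle E).
Proof.
have [fe ce] := bundle_framed ev_is_bundle.
have [fo co] := bundle_framed od_is_bundle.
split.
  move=> b /ber_frameP[e [f [f' [Ee Of bd bE]]]].
  have [oe be] := fe e Ee; have [of_ bf] := fo f Of.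
  split=> [|x bx]; first by rewrite bd; exact: openI.
  have [ff' bk] := bE x bx; move: bx; rewrite bd => -[ex fx].
  rewrite (_ : (fun k => b k x) = fun=> ber_frame e f' x).
    exact: ber_frame_is_basis (be x ex) (bf x fx) ff'.
  by apply/funext => k; rewrite bk.
move=> x; have [e Ee ex] := ce x; have [f Of fx] := co x.
have [oe be] := fe e Ee; have [of_ bf] := fo f Of.
(* The dual frame is chosen point by point, with value 0 off the domain of [f], where a frame of the
   Berezinian bundle asks nothing of it. *)
have h y : exists f' : 'I_(brank (od_bundle E)) -> dualmod (od_bundle E y),
    fdom f y -> dual_family (fun k => f k y) f'.
  have [fy|nfy] := pselect (fdom f y); last by exists (fun=> 0).
  by have [f' ff'] := dual_family_exists (bf y fy); exists f'.
pose f' y := projT1 (cid (h y)).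
have f'P y : fdom f y -> dual_family (fun k => f k y) (f' y) by rewrite /f'; case: cid.
pose b : lframe (ber_bundle E) (brank (ber_bundle E)) :=
  Frame (fdom e `&` fdom f) (fun _ y => ber_frame e f' y).
exists b; last by split.
exists e, f, f'; split=> // y [ey fy]; split=> // j k.
exact: f'P.
Qed.

(** The inverses [f'] may vary arbitrarily with [y]: the only matrix entry of [Phi] is the quotient
    of the even by the odd determinant of [f y], and these are smooth. *)
Lemma ber_family_smooth_at (N : manifold R) (p q : N -> M) z
    (f : forall z, chain_map (fiber_complex E (p z)) (fiber_complex E (q z)))
    (Phi : forall z, ber_bundle E (p z) -> ber_bundle E (q z)) :
  smooth_map p -> smooth_map q ->
  (\forall y \near z, exists f', mutually_inverse (f y) f' /\
     Phi y =1 ber_map (f y) f') ->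
  (forall i, @smooth_family_at R N M (E i) (E i) p q (fun y => f y i) z) ->
  smooth_family_at Phi z.
Proof.
move=> sp sq fP sf b b1 Bb Bb1 bz b1z.
have nb := framed_near ber_framed sp.1 Bb bz.
have nb1 := framed_near ber_framed sq.1 Bb1 b1z.
have [e [g [g' [Ee Og bd bE]]]] := ber_frameP Bb.
have [e1 [g1 [g1' [Ee1 Og1 b1d b1E]]]] := ber_frameP Bb1.
have : (fdom e `&` fdom g) (p z) by rewrite -bd.
move=> [ez gz].
have : (fdom e1 `&` fdom g1) (q z) by rewrite -b1d.
move=> [e1z g1z].
have fev := bundle_framed ev_is_bundle; have fod := bundle_framed od_is_bundle.
have ne := framed_near fev sp.1 Ee ez; have ne1 := framed_near fev sq.1 Ee1 e1z.
have ng := framed_near fod sp.1 Og gz; have ng1 := framed_near fod sq.1 Og1 g1z.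
have sdet_ev := smooth_at_det (ev_map_smooth sp sq sf Ee Ee1 ez e1z).
have sdet_od := smooth_at_det (od_map_smooth sp sq sf Og Og1 gz g1z).
have det_od0 : \det (@frame_mx R N M _ _ p q g g1 (fun y => od_map (f y)) z) != 0.
  have [f' [ff' _]] := nbhs_singleton fP.
  have [_ bg] := nbhs_singleton ng; have [_ bg1] := nbhs_singleton ng1.
  have := mxof_cancel bg bg1 (od_mapK ff') => /(congr1 determinant).
  rewrite det_mulmx det1; apply: contra_eq_neq => d0.
  by rewrite [X in X * _]d0 mul0r eq_sym oner_eq0.
move=> j k.
apply: (smooth_at_eq _ (smooth_atM sdet_ev (smooth_atV sdet_od det_od0))).
apply: filterS3 (filterI ne ng) (filterI ne1 ng1) (filterI fP (filterI nb nb1)).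
move=> y [[_ be] [_ bg]] [[_ be1] [_ bg1]] [[f' [ff' PhiE]] [[by_ _] [b1y bb1]]].
have [gg' bk] := bE _ by_; have [gg1' b1k] := b1E _ b1y.
have := @ber_map_frames R (fiber_complex E (p y)) (fiber_complex E (q y)) _ _
  (fun k => e k (p y)) _ _ _ _ _ bg gg' be1 bg1 gg1' _ _ ff'.
rewrite /frame_mx; set c := _ / _ => cE.
rewrite (mxof_uniq (A := \matrix_(_, _) c) bb1) ?mxE// => l.
rewrite PhiE bk [RHS](big_ord1) mxE b1k.
exact: cE.
Qed.

End BerBundle.

(** * The induced representation *)

Lemma dual_map_id (R : comNzRingType) (V : lmodType R) (f : {linear V -> V}) xi :
  (forall v, f v = v) -> dual_map f xi = xi.
Proof. by move=> fE; apply: submod_inj; apply/funext => v /=; rewrite fE. Qed.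

Lemma ext_map_id (R : comNzRingType) n (V : lmodType R) (f : {linear V -> V})
    (w : ext_pow n V) : (forall v, f v = v) -> ext_map f w = w.
Proof.
move=> fE; apply: submod_inj; apply/funext => xi /=; congr (submod_val w _).
by apply/funext => i; apply: dual_map_id.
Qed.

Lemma tensor_map_id (R : comNzRingType) (A B : lmodType R) (f : {linear A -> A})
    (g : {linear B -> B}) t :
  (forall v, f v = v) -> (forall v, g v = v) -> tensor_map f g t = t.
Proof.
move=> fE gE; apply: submod_inj; apply/funext => xi; apply/funext => eta.
by rewrite tensor_mapE !dual_map_id.
Qed.

Definition id_chain_map (R : comNzRingType) (C : cochain R) : chain_map C C :=
  @ChainMap R C C (fun i => idfun) (fun i v => erefl).

Lemma ber_map_id (R : comNzRingType) p q (C : cochain R) w :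
  @ber_map R p q C C (id_chain_map C) (id_chain_map C) w = w.
Proof.
apply: tensor_map_id => u; apply: ext_map_id => v; first exact: eq_dsum.
by apply: dual_map_id => x; apply: eq_dsum.
Qed.

(** The identity is the Berezinian action of the identity chain maps, which form a smooth family
    because each [E i] is a bundle. *)
Lemma ber_is_bundle (R : realType) (M : manifold R) (E : vcomplex M) :
  is_bundle (ber_bundle E).
Proof.
have fB := ber_framed E; split; [exact: fB.1|exact: fB.2|].
have idc : continuous (@id M) by move=> y; exact: cvg_id.
apply/(smooth_familyP _ fB fB idc idc) => x.
apply: (@ber_family_smooth_at R M E M id id x
  (fun y => id_chain_map (fiber_complex E y)) (fun=> id)
  (smooth_map_id M) (smooth_map_id M)).
  apply: nearW => y; exists (id_chain_map (fiber_complex E y)); split=> // w.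
  by rewrite ber_map_id.
by move=> i; apply: bundle_transition; apply: vbP.
Qed.

Section Induced.
Context (R : realType) (M : manifold R) (G : lie_groupoid M).
Context (E : vcomplex M) (Delta : weak_representation G E).

Lemma fiber_basis_exists (B : bundle_data M) x : framed B ->
  exists e : 'I_(brank B) -> B x, is_basis e.
Proof.
by move=> [fB cB]; have [e Be ex] := cB x; exists (fun k => e k x); apply (fB e Be).2.
Qed.

Fact garrow_inv_subproof x y (g : garrow G x y) :
  src (ginv (sval g)) = y /\ tgt (ginv (sval g)) = x.
Proof. by case: g => g [sg tg] /=; rewrite src_inv tgt_inv. Qed.

Definition garrow_inv x y (g : garrow G x y) : garrow G y x :=
  exist _ (ginv (sval g)) (garrow_inv_subproof g).

Lemma eq_garrow x y (g h : garrow G x y) : sval g = sval h -> g = h.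
Proof. by case: g h => g Hg [h Hh] /= gh; subst h; congr exist; apply: Prop_irrelevance. Qed.

Lemma arrow_comp_invl x y (g : garrow G x y) :
  arrow_comp (garrow_inv g) g = arrow_unit G x.
Proof. by apply: eq_garrow; case: g => g [sg tg] /=; rewrite inv_mul sg. Qed.

Lemma arrow_comp_invr x y (g : garrow G x y) :
  arrow_comp g (garrow_inv g) = arrow_unit G y.
Proof. by apply: eq_garrow; case: g => g [sg tg] /=; rewrite mul_inv tg. Qed.

Lemma wact_iso x y (g : garrow G x y) : unital Delta ->
  exists f f', mutually_inverse f f' /\ homotopic (wact Delta g) f.
Proof.
move=> unit_Delta.
have hb z i := fiber_basis_exists z (vbundle_framed (E i)).
pose b z i := projT1 (cid (hb z i)).
have bb z i : is_basis (b z i) by rewrite /b; case: cid.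
have [N EN] := vbounded E.
apply: (@homotopy_equivalence_iso R (fiber_complex E x) (fiber_complex E y)
  (fun i => brank (E i)) (b x) (b y) N _ (wact Delta (garrow_inv g)) (bb x) (bb y)).
- exact: EN.
- have [h hE] := wact_comp Delta (garrow_inv g) g; exists h => i v.
  by rewrite -hE arrow_comp_invl unit_Delta.
- have [h hE] := wact_comp Delta g (garrow_inv g); exists h => i v.
  by rewrite -hE arrow_comp_invr unit_Delta.
Qed.

Lemma ber_map_unique x y (phi psi : chain_map (fiber_complex E x) (fiber_complex E y))
    phi' psi' :
  mutually_inverse phi phi' -> mutually_inverse psi psi' -> homotopic phi psi ->
  @ber_map R (brank (ev_bundle E)) (brank (od_bundle E)) _ _ phi phi' =
  ber_map psi psi'.
Proof.
have [e be] := fiber_basis_exists x (bundle_framed (ev_is_bundle E)).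
have [f bf] := fiber_basis_exists x (bundle_framed (od_is_bundle E)).
have [e1 be1] := fiber_basis_exists y (bundle_framed (ev_is_bundle E)).
have [f1 bf1] := fiber_basis_exists y (bundle_framed (od_is_bundle E)).
exact: (@ber_map_homotopic R (fiber_complex E x) (fiber_complex E y) _ _
  e f e1 f1 phi psi phi' psi' be bf be1 bf1).
Qed.

(* A homotopy from [Delta_g0] to an isomorphism, extended with constant
   coefficients in local frames to the arrows near [g0]. *)
Lemma smooth_iso_near (g0 : G) : unital Delta ->
  exists f : forall g : G, chain_map (fiber_complex E (src g)) (fiber_complex E (tgt g)),
  [/\ forall g, homotopic (wact Delta (arrow_of g)) (f g),
      forall i, @smooth_family_at R G M (E i) (E i) (@src R M G) (@tgt R M G)
        (fun g => f g i) g0 &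
      \forall g \near g0, exists f', mutually_inverse (f g) f'].
Proof.
move=> unit_Delta.
have [phi [phi' [phiK /homotopic_sym[h0 h0E]]]] := wact_iso (arrow_of g0) unit_Delta.
have ss := src_smooth G; have st := tgt_smooth G.
have fr (z : M) i : exists e : lframe (E i) (brank (E i)), bframes (E i) e /\ fdom e z.
  by have [e Ee ez] := (vbundle_framed (E i)).2 z; exists e.
pose eps i := projT1 (cid (fr (src g0) i)).
have [Ee ez] : (forall i, bframes (E i) (eps i)) /\ (forall i, fdom (eps i) (src g0)).
  by split=> i; rewrite /eps; case: cid => ? [].
pose eta i := projT1 (cid (fr (tgt g0) i)).
have [Et tz] : (forall i, bframes (E i) (eta i)) /\ (forall i, fdom (eta i) (tgt g0)).
  by split=> i; rewrite /eta; case: cid => ? [].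
have beps i x : fdom (eps i) x -> is_basis (fun k => eps i k x).
  by have [_] := (vbundle_framed (E i)).1 _ (Ee i); apply.
have beta i x : fdom (eta i) x -> is_basis (fun k => eta i k x).
  by have [_] := (vbundle_framed (E i)).1 _ (Et i); apply.
pose H i := mxof (fun j => eps (i + 1) j (src g0)) (fun k => eta i k (tgt g0)) (h0 i).
(* Where the frame is not defined, the zero map is taken. The homotopy from Delta_g holds for every
   choice of [h]; smoothness and invertibility concern only arrows near [g0]. *)
have hex (g : G) i : exists h : {linear E (i + 1) (src g) -> E i (tgt g)},
    fdom (eps (i + 1)) (src g) ->
    forall j, h (eps (i + 1) j (src g)) = \sum_k H i j k *: eta i k (tgt g).
  have [eg|] := pselect (fdom (eps (i + 1)) (src g)); last by exists \0.
  by have [h hE] := linear_of_mx (fun k => eta i k (tgt g)) (H i) (beps _ _ eg); exists h.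
pose h g i := projT1 (cid (hex g i)).
have hE g i : fdom (eps (i + 1)) (src g) ->
    forall j, h g i (eps (i + 1) j (src g)) = \sum_k H i j k *: eta i k (tgt g).
  by rewrite /h; case: cid.
have h_g0 i : h g0 i =1 h0 i.
  apply: (linear_basis_eq (beps _ _ (ez (i + 1)))) => j.
  by rewrite hE// [RHS](mxofE (fun j => eps (i + 1) j (src g0)) (h0 i) j (beta _ _ (tz i))).
have sh i : @smooth_family_at R G M (E (i + 1)) (E i) (@src R M G) (@tgt R M G)
    (fun g => h g i) g0.
  apply: (@smooth_family_at_frames R G M (E (i + 1)) (E i) _ _ (fun g => h g i) g0
    _ _ (vbP (E (i + 1))) (vbP (E i)) ss st (Ee (i + 1)) (Et i) (ez _) (tz _)).
  move=> j k; apply: (@smooth_at_eq _ _ g0 _ _ _ (@smooth_at_cst R G g0 (H i j k))).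
  apply: filterS2 (framed_near (vbundle_framed (E (i + 1))) ss.1 (Ee _) (ez _))
    (framed_near (vbundle_framed (E i)) st.1 (Et i) (tz _)) => g [eg _] [tg _].
  by rewrite /frame_mx (mxof_uniq (beta _ _ tg) (hE g i eg)).
have [F FE] := @int_shift_family (fun i => forall g : G, {linear E i (src g) -> E i (tgt g)})
  (fun i g => wact Delta (arrow_of g) (i + 1) \+
     ((vdiff E i (tgt g) \o h g i) \+ (h g (i + 1) \o vdiff E (i + 1) (src g)))).
have Fd g i (v : E i (src g)) : F (i + 1) g (vdiff E i (src g) v) = vdiff E i (tgt g) (F i g v).
  elim/int_shift_ind: i v => i v; rewrite !FE /= !vdiff2 !linear0 addr0.
  have := cm_comm (wact Delta (arrow_of g)) v => /= ->.
  by rewrite !linearD/= vdiff2 add0r.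
pose f g := @ChainMap R (fiber_complex E (src g)) (fiber_complex E (tgt g))
  (fun i => F i g) (Fd g).
(* At [g0] the correction returns [phi] itself and not just a map homotopic to it, so invertibility
   is known there. *)
have F_g0 i : F i g0 =1 phi i.
  elim/int_shift_ind: i => i v; rewrite FE /= !h_g0.
  have /eqP := h0E i v; rewrite subr_eq => /eqP phiE.
  exact: (etrans (addrC _ _) (esym phiE)).
have sF i : @smooth_family_at R G M (E i) (E i) (@src R M G) (@tgt R M G)
    (fun g => F i g) g0.
  elim/int_shift_ind: i => i.
  have sd j (p : G -> M) : smooth_map p ->
      @smooth_family_at R G M (E j) (E (j + 1)) p p (fun g => vdiff E j (p g)) g0.
    move=> sp; apply: (smooth_family_at_pullback (Phi := fun x => vdiff E j x) sp).
    have idc : continuous (@id M) by move=> y; exact: cvg_id.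
    exact: ((@smooth_familyP R M M (E j) (E (j + 1)) id id (vdiff E j)
      (vbundle_framed (E j)) (vbundle_framed (E (j + 1))) idc idc).1
      (@vdiff_smooth R M E j) (p g0)).
  have sDelta := (smooth_familyP _ (vbundle_framed (E (i + 1)))
    (vbundle_framed (E (i + 1))) ss.1 st.1).1 (@wact_smooth R M G E Delta (i + 1)) g0.
  have s1 := smooth_family_at_comp (vbundle_framed (E i)) (vbundle_framed (E (i + 1)))
    st.1 st.1 (sh i) (sd i _ st).
  have s2 := smooth_family_at_comp (vbundle_framed (E (i + 1 + 1)))
    (vbundle_framed (E (i + 1))) ss.1 st.1 (sd (i + 1) _ ss) (sh (i + 1)).
  have fi := vbundle_framed (E (i + 1)).
  have := smooth_family_atD fi st.1 sDelta (smooth_family_atD fi st.1 s1 s2).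
  by apply: smooth_family_at_eq; apply: nearW => g v; rewrite FE.
exists f; split.
- move=> g; apply: homotopic_sym; exists (h g) => i v.
  by rewrite /f /= FE /= [LHS]addrAC subrr add0r.
- exact: sF.
(* Invertibility is an open condition degree by degree; since only finitely many degrees have
   non-zero rank, one neighbourhood serves them all. *)
have finE : finite_set [set i : int | brank (E i) <> 0%N].
  have [N EN] := vbounded E; apply: (@finite_set_bounded_int _ N) => i /= Ei.
  by have [/EN|] := ltP N%:Z `|i|.
(* The bases are left free: in degrees of rank 0 the chosen frames need not be defined throughout
   the neighbourhood, and there any bases give an invertible empty matrix. *)
pose inv i (g : G) := exists (e : 'I_(brank (E i)) -> E i (src g))
  (e' : 'I_(brank (E i)) -> E i (tgt g)),
  [/\ is_basis e, is_basis e' & mxof e e' (F i g) \in unitmx].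
have inv_near : \forall g \near g0, forall i, brank (E i) <> 0%N -> inv i g.
  apply: near_finite_set => // i _.
  have phi_unit : \det (@frame_mx R G M (E i) (E i) (@src R M G) (@tgt R M G)
      (eps i) (eta i) (fun g => F i g) g0) != 0.
    rewrite /frame_mx (eq_mxof _ _ (F_g0 i)).
    have [K _] := phiK i.
    have := mxof_cancel (beps _ _ (ez i)) (beta _ _ (tz i)) K => /(congr1 determinant).
    rewrite det_mulmx det1; apply: contra_eq_neq => ->.
    by rewrite mul0r eq_sym oner_eq0.
  have := smooth_at_neq0 (smooth_at_det (sF i _ _ (Ee i) (Et i) (ez i) (tz i))) phi_unit.
  apply: filterS3 (framed_near (vbundle_framed (E i)) ss.1 (Ee i) (ez i))
    (framed_near (vbundle_framed (E i)) st.1 (Et i) (tz i)) => g [_ be] [_ bt] det0.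
  exists (fun k => eps i k (src g)), (fun k => eta i k (tgt g)); split=> //.
  by rewrite unitmxE unitfE.
apply: filterS inv_near => g invg.
have {}invg i : inv i g.
  have [Ei|/eqP/invg//] := eqVneq (brank (E i)) 0%N.
  have [e be] := fiber_basis_exists (src g) (vbundle_framed (E i)).
  have [e' be'] := fiber_basis_exists (tgt g) (vbundle_framed (E i)).
  exists e, e'; split=> //; move: (mxof _ _ _); rewrite Ei => A.
  by rewrite unitmxE det_mx00 unitr1.
have Finv i : exists F' : {linear E i (tgt g) -> E i (src g)},
    cancel (F i g) F' /\ cancel F' (F i g).
  by have [e [e' [be be' ue]]] := invg i; exact: (unitmx_linear_inverse be be' ue).
pose F' i := projT1 (cid (Finv i)).
have FK i : cancel (F i g) (F' i) by rewrite /F'; case: cid => ? [].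
have FK' i : cancel (F' i) (F i g) by rewrite /F'; case: cid => ? [].
have F'd := @mutually_inverse_comm R (fiber_complex E (src g)) (fiber_complex E (tgt g))
  (fun i => F i g) F' (Fd g) FK FK'.
exists (@ChainMap R (fiber_complex E (tgt g)) (fiber_complex E (src g)) F' F'd) => i.
by split; [exact: FK|exact: FK'].
Qed.

End Induced.

Theorem theorem6p7 (R : realType) (M : manifold R) (G : lie_groupoid M)
    (E : vcomplex M) (Delta : weak_representation G E) (hDelta : unital Delta) :
  exists! Dhat : forall x y : M, garrow G x y -> ber_bundle E x -> ber_bundle E y,
    is_representation Dhat /\ induced_by Delta Dhat.
Proof.
(* An isomorphism and an inverse are picked for each arrow with no compatibility among arrows;
   [DhatE] shows that the choice does not matter. *)
pose phi x y (g : garrow G x y) := projT1 (cid (wact_iso g hDelta)).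
have phi_ex x y (g : garrow G x y) : exists phi', mutually_inverse (phi x y g) phi' /\
    homotopic (wact Delta g) (phi x y g) := projT2 (cid (wact_iso g hDelta)).
pose phi' x y (g : garrow G x y) := projT1 (cid (phi_ex x y g)).
have phiP x y (g : garrow G x y) : mutually_inverse (phi x y g) (phi' x y g) /\
    homotopic (wact Delta g) (phi x y g) := projT2 (cid (phi_ex x y g)).
pose Dhat x y (g : garrow G x y) : ber_bundle E x -> ber_bundle E y :=
  ber_map (phi x y g) (phi' x y g).
have DhatE x y (g : garrow G x y) f f' : mutually_inverse f f' ->
    homotopic (wact Delta g) f -> Dhat x y g = @ber_map R _ _ _ _ f f'.
  move=> ff' gf; have [phiK gphi] := phiP x y g.
  apply: (ber_map_unique phiK ff').
  exact: homotopic_trans (homotopic_sym gphi) gf.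
exists Dhat; split; last first.
  (* [induced_by] prescribes the action through every isomorphism homotopic to Delta_g, in
     particular through the chosen one. *)
  move=> D [_ DD].
  apply: functional_extensionality_dep => x; apply: functional_extensionality_dep => y.
  apply/funext => g; have [phiK gphi] := phiP x y g.
  by rewrite ((DD x y g).2 _ _ phiK gphi).
split; last first.
  move=> x y g; split; last exact: DhatE.
  by have [phiK gphi] := phiP x y g; exists (phi x y g), (phi' x y g).
split.
- by split; first exact: ber_is_bundle.
- move=> x y g; split; first exact: ber_map_linear.
  have [phiK _] := phiP x y g.
  exists (ber_map (phi' x y g) (phi x y g)); first exact: ber_mapK.
  by apply: ber_mapK; apply: mutually_inverse_sym.
- move=> x y z g h; have [gK gh] := phiP y z g; have [hK hh] := phiP x y h.
  (* The isomorphism chosen for the product may be replaced by the composite of those chosen for the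
     factors, on which the Berezinian is multiplicative. *)
  rewrite (DhatE _ _ _ _ _ (mutually_inverse_comp gK hK)).
    by apply/funext => w; apply: ber_map_comp.
  apply: homotopic_trans (homotopic_sym (wact_comp Delta g h)) _.
  exact: homotopic_comp.
- have ss := src_smooth G; have st := tgt_smooth G.
  apply/(smooth_familyP _ (ber_framed E) (ber_framed E) ss.1 st.1) => g0.
  have [f [fh fs fi]] := smooth_iso_near g0 hDelta.
  (* Near [g0] the chosen isomorphisms give way to the smooth family [f], which computes the same
     [Dhat]. *)
  apply: (ber_family_smooth_at (f := f) ss st _ fs).
  apply: filterS fi => g [f' ff']; exists f'; split=> // w.
  by rewrite (DhatE _ _ _ _ _ ff' (fh g)).
Qed.
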